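(* The operad of pre-Lie triple systems is the $\mathcal{A}$-splitting of the operad $\mathbf{LTS}$ of Lie triple systems. Precisely, let $\mathbf{LTS}=\mathcal{P}_E/(r_1,r_2)$ and let $\mathcal{A}Sp(\mathbf{LTS})$ be its $\mathcal{A}$-splitting. Then $$\mathcal{A}Sp(\mathbf{LTS})=\mathbf{pre\text{-}LTS}:=\mathcal{P}_{\mathcal{A}Sp(E)}\big/\big(\mathcal{A}Sp(r_1),\ \mathcal{A}Sp_{\{1\}}(r_2),\ \mathcal{A}Sp_{\{3\}}(r_2)\big),$$ where $\mathcal{A}Sp(r_1)$ stands for the relations $\mathcal{A}Sp_{\{j\}}(r_1)$, $1\le j\le 3$; that is, the operadic ideal of $\mathcal{P}_{\mathcal{A}Sp(E)}$ generated by all $\mathcal{A}Sp_{\{j\}}(r_1)$ ($1\le j\le 3$) and $\mathcal{A}Sp_{\{j\}}(r_2)$ ($1\le j\le 5$) is already generated by the $\mathcal{A}Sp_{\{j\}}(r_1)$ ($1\le j\le 3$), $\mathcal{A}Sp_{\{1\}}(r_2)$ and $\mathcal{A}Sp_{\{3\}}(r_2)$.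
   Context: Let $\mathbf{K}$ be a field of characteristic different from $2$. Operads are symmetric $\mathbf{K}$-linear operads; $\mathcal{P}_M$ denotes the free operad on an $\mathbb{S}$-module $M$, described by trees with vertices decorated by $M$ and labelled leaves. The right $\mathbb{S}_n$-action satisfies $f^{\sigma}(x_1,\dots,x_n)=f(x_{\sigma^{-1}(1)},\dots,x_{\sigma^{-1}(n)})$. The operad $\mathbf{LTS}$: $E$ is the $\mathbb{S}$-module concentrated in arity $3$, with basis $X_1,X_2,X_3$ of $E(3)$ and right action $X_i^{\sigma}=\varepsilon(\sigma)X_{\sigma^{-1}(i)}$ ($\varepsilon$ is the signature). Here $X_1,X_2,X_3$ represent the operations $(a_1,a_2,a_3)\mapsto[a_2,a_3,a_1],\ [a_3,a_1,a_2],\ [a_1,a_2,a_3]$. Then $\mathbf{LTS}=\mathcal{P}_E/(r_1,r_2)$ with $r_1=X_1(x_1,x_2,x_3)+X_2(x_1,x_2,x_3)+X_3(x_1,x_2,x_3)$, $r_2=X_3(x_1,x_2,X_3(x_3,x_4,x_5))-X_3(X_3(x_1,x_2,x_3),x_4,x_5)-X_3(x_3,X_3(x_1,x_2,x_4),x_5)-X_3(x_3,x_4,X_3(x_1,x_2,x_5))$, where an expression in the variables $x_i$ denotes the tree whose leaves are labelled accordingly. The $\mathcal{A}$-splitting: $\mathcal{A}Sp(E)$ is the $\mathbb{S}$-module concentrated in arity $3$ with $\mathcal{A}Sp(E)(3)=E(3)\otimes(\mathbf{K}e_1\oplus\mathbf{K}e_2\oplus\mathbf{K}e_3)$. Write $\binom{w}{e_j}=w\otimes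 e_j$; the action is $\binom{w}{e_j}^{\sigma}=\binom{w^{\sigma}}{e_{\sigma^{-1}(j)}}$. Put $\binom{w}{\star}=\binom{w}{e_1}+\binom{w}{e_2}+\binom{w}{e_3}$. For a tree $t$ with leaves labelled by $1,\dots,n$ and vertices decorated by elements of $\{X_1,X_2,X_3\}$, and for $j\in\{1,\dots,n\}$, the element $\mathcal{A}Sp_{\{j\}}(t)\in\mathcal{P}_{\mathcal{A}Sp(E)}(n)$ is obtained by replacing the decoration $w$ of each vertex by $\binom{w}{e_i}$ if the leaf labelled $j$ lies in the subtree grafted at the $i$-th input of that vertex, and by $\binom{w}{\star}$ if the leaf labelled $j$ does not lie above that vertex. This is extended linearly to linear combinations of trees; in particular $\mathcal{A}Sp_{\{j\}}$ is applied term by term to the three trees in the expression $r_1=X_1(x_1,x_2,x_3)+X_2(x_1,x_2,x_3)+X_3(x_1,x_2,x_3)$ and to the four trees in the expression $r_2=X_3(x_1,x_2,X_3(x_3,x_4,x_5))-X_3(X_3(x_1,x_2,x_3),x_4,x_5)-X_3(x_3,X_3(x_1,x_2,x_4),x_5)-X_3(x_3,x_4,X_3(x_1,x_2,x_5))$. The $\mathcal{A}$-splitting of $\mathbf{LTS}$ is $\mathcal{A}Sp(\mathbf{LTS})=\mathcal{P}_{\mathcal{A}Sp(E)}/(\mathcal{A}Sp_{\{j\}}(r_1),1\le j\le3;\ \mathcal{A}Sp_{\{j\}}(r_2),1\le j\le 5)$, the quotient by the generated operadic ideal. *)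

(* Defs.v *)
From HB Require Import structures.
From mathcomp Require Import all_boot all_fingroup all_algebra.
From mathcomp Require Import ring_quotient generic_quotient.
From mathcomp Require Import boolp.
From mathcomp.multinomials Require Import freeg.
From mathcomp Require Import zify.

Set Implicit Arguments.
Unset Strict Implicit.
Unset Printing Implicit Defensive.

Import GRing.Theory.
Local Open Scope ring_scope.
Local Open Scope quotient_scope.

Record submodule (K : fieldType) (V : lmodType K) := Submodule {
  in_sub :> V -> Prop;
  submodule0 : in_sub 0;
  submoduleP : forall a u v, in_sub u -> in_sub v -> in_sub (a *: u + v)
}.

Definition subpred (K : fieldType) (V : lmodType K) (S : submodule V) : {pred V} :=
  fun v => `[< S v >].

Lemma subpred_closed (K : fieldType) (V : lmodType K) (S : submodule V) :
  submod_closed (subpred S).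
Proof.
split=> [|a u v /asboolP Su /asboolP Sv]; apply/asboolP.
  exact: submodule0.
exact: submoduleP.
Qed.

HB.instance Definition _ (K : fieldType) (V : lmodType K) (S : submodule V) :=
  GRing.isSubmodClosed.Build K V (subpred S) (subpred_closed S).

Definition lquot (K : fieldType) (V : lmodType K) (S : submodule V) :=
  Quotient.quot (subpred S).

HB.instance Definition _ (K : fieldType) (V : lmodType K) (S : submodule V) :=
  GRing.Zmodule.on (lquot S).

Definition lpi (K : fieldType) (V : lmodType K) (S : submodule V) (v : V) :
  lquot S := \pi_(Quotient.quot (subpred S)) v.

Definition lrepr (K : fieldType) (V : lmodType K) (S : submodule V)
  (x : lquot S) : V := repr (x : Quotient.quot (subpred S)).

Lemma lreprK (K : fieldType) (V : lmodType K) (S : submodule V) (x : lquot S) :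
  lpi S (lrepr x) = x.
Proof. exact: reprK. Qed.

Lemma lpiP (K : fieldType) (V : lmodType K) (S : submodule V) u v :
  lpi S u = lpi S v <-> S (u - v).
Proof.
have E := Quotient.idealrBE (subpred S) u v.
split=> [/eqP Euv|Suv].
  by move: E; rewrite [RHS]Euv => /asboolP.
by apply/eqP; rewrite -[X in is_true X]E; apply/asboolP.
Qed.

Lemma lpiB (K : fieldType) (V : lmodType K) (S : submodule V) u v :
  lpi S (u - v) = lpi S u - lpi S v.
Proof. exact: raddfB (\pi_(Quotient.quot (subpred S))) u v. Qed.

Lemma lpi0 (K : fieldType) (V : lmodType K) (S : submodule V) : lpi S 0 = 0.
Proof. exact: raddf0 (\pi_(Quotient.quot (subpred S))). Qed.

Lemma lpiD (K : fieldType) (V : lmodType K) (S : submodule V) u v :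
  lpi S (u + v) = lpi S u + lpi S v.
Proof. exact: raddfD (\pi_(Quotient.quot (subpred S))) u v. Qed.

Definition lquot_scale (K : fieldType) (V : lmodType K) (S : submodule V)
  (a : K) (x : lquot S) : lquot S := lpi S (a *: lrepr x).

Lemma lquot_scaleE (K : fieldType) (V : lmodType K) (S : submodule V) a v :
  lquot_scale a (lpi S v) = lpi S (a *: v).
Proof.
apply/lpiP; rewrite -scalerBr -[_ *: _]addr0.
apply: submoduleP; last exact: submodule0.
by apply/lpiP; rewrite lreprK.
Qed.

Lemma lquot_scaleA (K : fieldType) (V : lmodType K) (S : submodule V) a b
  (x : lquot S) : lquot_scale a (lquot_scale b x) = lquot_scale (a * b) x.
Proof. by rewrite -[x]lreprK !lquot_scaleE scalerA. Qed.

Lemma lquot_scale1 (K : fieldType) (V : lmodType K) (S : submodule V) :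
  left_id 1 (@lquot_scale K V S).
Proof. by move=> x; rewrite -[x]lreprK !lquot_scaleE scale1r. Qed.

Lemma lquot_scaleDr (K : fieldType) (V : lmodType K) (S : submodule V) :
  right_distributive (@lquot_scale K V S) +%R.
Proof.
move=> a x y; rewrite -[x]lreprK -[y]lreprK -lpiD !lquot_scaleE.
by rewrite scalerDr lpiD.
Qed.

Lemma lquot_scaleDl (K : fieldType) (V : lmodType K) (S : submodule V)
  (x : lquot S) : {morph (@lquot_scale K V S)^~ x : a b / a + b}.
Proof. by move=> a b; rewrite -[x]lreprK !lquot_scaleE scalerDl lpiD. Qed.

HB.instance Definition _ (K : fieldType) (V : lmodType K) (S : submodule V) :=
  GRing.Zmodule_isLmodule.Build K (lquot S) (@lquot_scaleA K V S)
    (@lquot_scale1 K V S) (@lquot_scaleDr K V S) (@lquot_scaleDl K V S).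

Lemma lpiZ (K : fieldType) (V : lmodType K) (S : submodule V) a v :
  lpi S (a *: v) = a *: lpi S v.
Proof. by rewrite -lquot_scaleE. Qed.

Lemma lpi_linear (K : fieldType) (V : lmodType K) (S : submodule V) :
  linear (lpi S).
Proof. by move=> a u v; rewrite lpiD lpiZ. Qed.

Definition span_pred (K : fieldType) (V : lmodType K) (G : V -> Prop) (v : V) :=
  forall S : submodule V, (forall g, G g -> S g) -> S v.

Lemma span_pred0 (K : fieldType) (V : lmodType K) (G : V -> Prop) :
  span_pred G 0.
Proof. by move=> S _; apply: submodule0. Qed.

Lemma span_predP (K : fieldType) (V : lmodType K) (G : V -> Prop) a u v :
  span_pred G u -> span_pred G v -> span_pred G (a *: u + v).
Proof. by move=> Gu Gv S GS; apply: submoduleP; [apply: Gu|apply: Gv]. Qed.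

Definition span (K : fieldType) (V : lmodType K) (G : V -> Prop) : submodule V :=
  Submodule (@span_pred0 K V G) (@span_predP K V G).

Lemma mem_span (K : fieldType) (V : lmodType K) (G : V -> Prop) v :
  G v -> span G v.
Proof. by move=> Gv S GS; apply: GS. Qed.

Definition qlift (K : fieldType) (V W : lmodType K) (S : submodule V)
  (f : V -> W) (x : lquot S) : W := f (lrepr x).

Lemma linear_sub0 (K : fieldType) (V W : lmodType K) (f : V -> W) :
  linear f -> (forall u v, f (u - v) = f u - f v) /\ f 0 = 0.
Proof.
move=> Lf.
have f0 : f 0 = 0.
  have := Lf 1 0 0; rewrite !scale1r addr0 => /eqP.
  by rewrite -[X in X == _]addr0 (inj_eq (addrI _)) eq_sym => /eqP.
split=> // u v; rewrite addrC -scaleN1r Lf scaleN1r addrC.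
by [].
Qed.

Lemma qliftE (K : fieldType) (V W : lmodType K) (S : submodule V)
  (f : V -> W) : linear f -> (forall v, S v -> f v = 0) ->
  forall v, qlift f (lpi S v) = f v.
Proof.
move=> Lf Sf v; apply/eqP; rewrite /qlift -subr_eq0 -(linear_sub0 Lf).1.
apply/eqP/Sf; apply: (lpiP S _ _).1; exact: lreprK.
Qed.

Lemma qlift_linear (K : fieldType) (V W : lmodType K) (S : submodule V)
  (f : V -> W) : linear f -> (forall v, S v -> f v = 0) ->
  linear (@qlift K V W S f).
Proof.
move=> Lf Sf a x y; rewrite -[x]lreprK -[y]lreprK -lpiZ -lpiD.
by rewrite !qliftE // Lf.
Qed.

Lemma linear_span0 (K : fieldType) (V W : lmodType K) (G : V -> Prop)
  (f : V -> W) : linear f -> (forall v, G v -> f v = 0) ->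
  forall v, span G v -> f v = 0.
Proof.
move=> Lf Gf v Gv.
have k0 : f 0 = 0 by case: (linear_sub0 Lf).
have kP a u w : f u = 0 -> f w = 0 -> f (a *: u + w) = 0.
  by move=> fu fw; rewrite Lf fu fw scaler0 addr0.
exact: (Gv (Submodule k0 kP) Gf).
Qed.

(* The product of permutations in the library reads from left to right,        *)
(* (s * t) j = t (s j), so (x^s)^t = x^(s o t) is written with t * s.          *)
Record smodule (K : fieldType) := Smodule {
  sm_sort :> nat -> lmodType K;
  sm_act : forall n, sm_sort n -> 'S_n -> sm_sort n;
  sm_act_linear : forall n (s : 'S_n), linear (fun x => sm_act x s);
  sm_act1 : forall n (x : sm_sort n), sm_act x 1%g = x;
  sm_actM : forall n (x : sm_sort n) (s t : 'S_n),
    sm_act (sm_act x s) t = sm_act x (t * s)%g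
}.

(* Position in p o_i q, with q of arity n, of the input j != i of p; the input *)
(* j of q has position i + j. Inputs are numbered from 0.                      *)
Definition opos (i n j : nat) : nat := if (j < i)%N then j else (j + n).-1.

(* The permutation of the inputs of p o_i q induced by the permutation s of    *)
(* the inputs of p, resp. by the permutation s of the inputs of q.             *)
Definition perm_outer m n (i : 'I_m) (s : 'S_m) (tau : 'S_(m + n).-1) : Prop :=
  (forall (j : 'I_m) (x : 'I_(m + n).-1), j != i -> x = opos i n j :> nat ->
     tau x = opos (s i) n (s j) :> nat) /\
  (forall (j : 'I_n) (x : 'I_(m + n).-1), x = (i + j)%N :> nat ->
     tau x = (s i + j)%N :> nat).

Definition perm_inner m n (i : 'I_m) (s : 'S_n) (tau : 'S_(m + n).-1) : Prop :=
  (forall (j : 'I_m) (x : 'I_(m + n).-1), j != i -> x = opos i n j :> nat ->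
     tau x = opos i n j :> nat) /\
  (forall (j : 'I_n) (x : 'I_(m + n).-1), x = (i + j)%N :> nat ->
     tau x = (i + s j)%N :> nat).

(* Operads through partial compositions p o_i q. The ecast's are transports    *)
(* along equalities of arities.                                                *)
Record operad (K : fieldType) := Operad {
  op_smod :> smodule K;
  op_id : op_smod 1%N;
  op_comp : forall m n, 'I_m -> op_smod m -> op_smod n -> op_smod (m + n).-1;
  op_comp_linl : forall m n (i : 'I_m) (q : op_smod n),
    linear (fun p => op_comp i p q);
  op_comp_linr : forall m n (i : 'I_m) (p : op_smod m),
    linear (fun q : op_smod n => op_comp i p q);
  op_comp1p : forall n (q : op_smod n), op_comp (ord0 : 'I_1) op_id q = q;
  op_compp1 : forall m (i : 'I_m) (p : op_smod m) (e : (m + 1).-1 = m),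
    ecast k (op_smod k) e (op_comp i p op_id) = p;
  op_comp_seq : forall l m n (i : 'I_l) (j : 'I_m) (ij : 'I_(l + m).-1)
      (p : op_smod l) (q : op_smod m) (r : op_smod n)
      (e : ((l + m).-1 + n).-1 = (l + (m + n).-1).-1),
    ij = (i + j)%N :> nat ->
    ecast k (op_smod k) e (op_comp ij (op_comp i p q) r)
      = op_comp i p (op_comp j q r);
  op_comp_par : forall l m n (i k : 'I_l) (i' : 'I_(l + n).-1)
      (k' : 'I_(l + m).-1) (p : op_smod l) (q : op_smod m) (r : op_smod n)
      (e : ((l + m).-1 + n).-1 = ((l + n).-1 + m).-1),
    (i < k)%N -> i' = i :> nat -> k' = (k + m).-1 :> nat ->
    ecast k (op_smod k) e (op_comp k' (op_comp i p q) r)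
      = op_comp i' (op_comp k p r) q;
  op_comp_actl : forall m n (i : 'I_m) (s : 'S_m) (tau : 'S_(m + n).-1)
      (p : op_smod m) (q : op_smod n),
    perm_outer i s tau ->
    op_comp i (sm_act p s) q = sm_act (op_comp (s i) p q) tau;
  op_comp_actr : forall m n (i : 'I_m) (s : 'S_n) (tau : 'S_(m + n).-1)
      (p : op_smod m) (q : op_smod n),
    perm_inner i s tau ->
    op_comp i p (sm_act q s) = sm_act (op_comp i p q) tau
}.

Record is_ideal (K : fieldType) (P : operad K) (I : forall n, P n -> Prop) :
    Prop := IsIdeal {
  ideal0 : forall n, I n 0;
  ideal_lin : forall n a (x y : P n), I n x -> I n y -> I n (a *: x + y);
  ideal_act : forall n (x : P n) s, I n x -> I n (sm_act x s);
  ideal_compl : forall m n (i : 'I_m) (p : P m) (q : P n),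
    I m p -> I (m + n).-1 (op_comp i p q);
  ideal_compr : forall m n (i : 'I_m) (p : P m) (q : P n),
    I n q -> I (m + n).-1 (op_comp i p q)
}.

Definition ideal (K : fieldType) (P : operad K) :=
  {I : forall n, P n -> Prop | is_ideal I}.

Definition ideal_pred (K : fieldType) (P : operad K) (I : ideal P) :
  forall n, P n -> Prop := sval I.

Definition gen_pred (K : fieldType) (P : operad K)
    (R : forall n, P n -> Prop) (n : nat) (x : P n) : Prop :=
  forall I : ideal P,
    (forall k (r : P k), R k r -> ideal_pred I r) -> ideal_pred I x.

Lemma gen_pred_is_ideal (K : fieldType) (P : operad K)
  (R : forall n, P n -> Prop) : is_ideal (gen_pred R).
Proof.
split.
- by move=> n I _; apply: (ideal0 (svalP I)).
- move=> n a x y Rx Ry I RI.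
  by apply: (ideal_lin (svalP I)); [apply: Rx | apply: Ry].
- by move=> n x s Rx I RI; apply: (ideal_act (svalP I)); apply: Rx.
- by move=> m n i p q Rp I RI; apply: (ideal_compl (svalP I)); apply: Rp.
- by move=> m n i p q Rq I RI; apply: (ideal_compr (svalP I)); apply: Rq.
Qed.

Definition gen_ideal (K : fieldType) (P : operad K)
  (R : forall n, P n -> Prop) : ideal P := exist _ _ (gen_pred_is_ideal R).

Lemma ideal_submodule_proof (K : fieldType) (P : operad K) (I : ideal P) n :
  ideal_pred I (0 : P n) /\
  (forall a (u v : P n), ideal_pred I u -> ideal_pred I v ->
    ideal_pred I (a *: u + v)).
Proof. by split; [apply: (ideal0 (svalP I)) | apply: (ideal_lin (svalP I))]. Qed.

Definition ideal_sub (K : fieldType) (P : operad K) (I : ideal P) (n : nat) :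
  submodule (P n) :=
  Submodule (ideal_submodule_proof I n).1 (ideal_submodule_proof I n).2.

Definition quo_sort (K : fieldType) (P : operad K) (I : ideal P) (n : nat) :
  lmodType K := lquot (ideal_sub I n).

Definition quo_act (K : fieldType) (P : operad K) (I : ideal P) (n : nat)
  (x : quo_sort I n) (s : 'S_n) : quo_sort I n :=
  lpi (ideal_sub I n) (sm_act (lrepr x) s).

Definition quo_comp (K : fieldType) (P : operad K) (I : ideal P) (m n : nat)
  (i : 'I_m) (x : quo_sort I m) (y : quo_sort I n) : quo_sort I (m + n).-1 :=
  lpi (ideal_sub I (m + n).-1) (op_comp i (lrepr x) (lrepr y)).

Lemma quo_actE (K : fieldType) (P : operad K) (I : ideal P) n (p : P n) s :
  quo_act (lpi (ideal_sub I n) p) s = lpi (ideal_sub I n) (sm_act p s).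
Proof.
apply/lpiP; rewrite -(linear_sub0 (sm_act_linear s)).1 /=.
by apply: (ideal_act (svalP I)); apply/(@lpiP _ _ (ideal_sub I n)); rewrite lreprK.
Qed.

Lemma quo_compE (K : fieldType) (P : operad K) (I : ideal P) m n (i : 'I_m)
  (p : P m) (q : P n) :
  quo_comp i (lpi (ideal_sub I m) p) (lpi (ideal_sub I n) q)
    = lpi (ideal_sub I _) (op_comp i p q).
Proof.
rewrite /quo_comp; set q' := lrepr (lpi _ q).
transitivity (lpi (ideal_sub I (m + n).-1) (op_comp i p q')).
  apply/lpiP; rewrite -(linear_sub0 (op_comp_linl i q')).1 /=.
  by apply: (ideal_compl (svalP I)); apply/(@lpiP _ _ (ideal_sub I m)); rewrite lreprK.
apply/lpiP; rewrite -(linear_sub0 (op_comp_linr i p)).1 /=.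
by apply: (ideal_compr (svalP I)); apply/(@lpiP _ _ (ideal_sub I n)); rewrite lreprK.
Qed.

Lemma quo_act_linear (K : fieldType) (P : operad K) (I : ideal P) n (s : 'S_n) :
  linear (fun x : quo_sort I n => quo_act x s).
Proof.
move=> a x y; rewrite -[x]lreprK -[y]lreprK -lpiZ -lpiD !quo_actE.
by rewrite (sm_act_linear s a) lpi_linear.
Qed.

Lemma quo_act1 (K : fieldType) (P : operad K) (I : ideal P) n
  (x : quo_sort I n) : quo_act x 1%g = x.
Proof. by rewrite -[x]lreprK quo_actE sm_act1. Qed.

Lemma quo_actM (K : fieldType) (P : operad K) (I : ideal P) n
  (x : quo_sort I n) (s t : 'S_n) :
  quo_act (quo_act x s) t = quo_act x (t * s)%g.
Proof. by rewrite -[x]lreprK !quo_actE sm_actM. Qed.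

Definition quo_smodule (K : fieldType) (P : operad K) (I : ideal P) :
  smodule K := Smodule (@quo_act_linear K P I) (@quo_act1 K P I)
    (@quo_actM K P I).

Lemma ecast_lpi (K : fieldType) (P : operad K) (I : ideal P) m n (e : m = n)
  (p : P m) : ecast k (quo_sort I k) e (lpi (ideal_sub I m) p)
    = lpi (ideal_sub I n) (ecast k (P k) e p).
Proof. by case: n / e. Qed.

Lemma quo_comp_linl (K : fieldType) (P : operad K) (I : ideal P) m n (i : 'I_m)
  (q : quo_smodule I n) : linear (fun p : quo_smodule I m => quo_comp i p q).
Proof.
move=> a x y; rewrite -[x]lreprK -[y]lreprK -[q]lreprK -lpiZ -lpiD !quo_compE.
by rewrite (op_comp_linl i _ a) lpi_linear.
Qed.

Lemma quo_comp_linr (K : fieldType) (P : operad K) (I : ideal P) m n (i : 'I_m)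
  (p : quo_smodule I m) : linear (fun q : quo_smodule I n => quo_comp i p q).
Proof.
move=> a x y; rewrite -[x]lreprK -[y]lreprK -[p]lreprK -lpiZ -lpiD !quo_compE.
by rewrite (op_comp_linr i _ a) lpi_linear.
Qed.

Definition quotient_operad (K : fieldType) (P : operad K) (I : ideal P) :
  operad K.
Proof.
refine (@Operad K (quo_smodule I) (lpi (ideal_sub I 1) (op_id P))
  (@quo_comp K P I) (@quo_comp_linl K P I) (@quo_comp_linr K P I) _ _ _ _ _ _).
- abstract by move=> n q; rewrite -[q]lreprK quo_compE op_comp1p.
- abstract by move=> m i p e; rewrite -[p]lreprK quo_compE ecast_lpi op_compp1.
- abstract by move=> l m n i j ij p q r e Eij; rewrite -[p]lreprK -[q]lreprK
    -[r]lreprK !quo_compE ecast_lpi (op_comp_seq (i := i) (j := j)).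
- abstract by move=> l m n i k i' k' p q r e ik Ei Ek; rewrite -[p]lreprK
    -[q]lreprK -[r]lreprK !quo_compE ecast_lpi
    (op_comp_par (i := i) (k := k) (i' := i')).
- abstract by move=> m n i s tau p q H; rewrite -[p]lreprK -[q]lreprK /=
    quo_actE !quo_compE quo_actE (op_comp_actl _ _ H).
- abstract by move=> m n i s tau p q H; rewrite -[p]lreprK -[q]lreprK /=
    quo_actE !quo_compE quo_actE (op_comp_actr _ _ H).
Defined.
Inductive tree (K : fieldType) (M : smodule K) : Type :=
| Leaf of nat
| Node k of M k & ('I_k -> tree M).
Arguments Leaf {K M} _.
Arguments Node {K M k} _ _.

Fixpoint leaves (K : fieldType) (M : smodule K) (t : tree M) : seq nat :=
  match t with
  | Leaf l => [:: l]
  | Node _ _ f => flatten [seq leaves (f i) | i <- enum 'I_ _]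
  end.

(* Trees with n leaves, labelled bijectively by 0, ..., n - 1.                 *)
Record ntree (K : fieldType) (M : smodule K) (n : nat) := NTree {
  tree_of :> tree M;
  ntree_labels : perm_eq (leaves tree_of) (iota 0 n)
}.

HB.instance Definition _ (K : fieldType) (M : smodule K) (n : nat) :=
  gen_eqMixin (ntree M n).
HB.instance Definition _ (K : fieldType) (M : smodule K) (n : nat) :=
  gen_choiceMixin (ntree M n).

Fixpoint subst_leaves (K : fieldType) (M : smodule K) (g : nat -> tree M)
    (t : tree M) : tree M :=
  match t with
  | Leaf l => g l
  | Node _ d f => Node d (fun i => subst_leaves g (f i))
  end.

Definition relabel (K : fieldType) (M : smodule K) (h : nat -> nat) (t : tree M) :=
  subst_leaves (fun l => Leaf (h l)) t.

Definition perm_label n (s : 'S_n) (l : nat) : nat :=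
  oapp (fun i : 'I_n => val (s i)) l (insub l).

(* In f^s(x_1, ..., x_n), the variable x_j is put at the input s j of f, so    *)
(* the label j of this input becomes s^-1 j.                                   *)
Definition tree_act (K : fieldType) (M : smodule K) n (s : 'S_n) (t : tree M) :=
  relabel (perm_label s^-1%g) t.

(* The tree s, with n leaves, is grafted on the leaf i of t.                   *)
Definition tree_graft (K : fieldType) (M : smodule K) (i n : nat) (t s : tree M) :=
  subst_leaves (fun l => if l == i then relabel (addn i) s else Leaf (opos i n l))
    t.

(* t, u, v only differ by the decoration of one vertex, which is a d + d' in   *)
(* t, d in u and d' in v.                                                      *)
Inductive tree_lin (K : fieldType) (M : smodule K) (a : K) :
    tree M -> tree M -> tree M -> Prop :=
| tree_lin_root k (d d' : M k) f :
    tree_lin a (Node (a *: d + d') f) (Node d f) (Node d' f)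
| tree_lin_above k (d : M k) f g h i :
    (forall j, j != i -> f j = g j /\ f j = h j) ->
    tree_lin a (f i) (g i) (h i) ->
    tree_lin a (Node d f) (Node d g) (Node d h).

(* t and u only differ above one vertex, where the subtree                     *)
(* d^s(f_1, ..., f_k) of t becomes d(f_{s^-1(1)}, ..., f_{s^-1(k)}) in u.      *)
Inductive tree_sym (K : fieldType) (M : smodule K) : tree M -> tree M -> Prop :=
| tree_sym_root k (d : M k) (s : 'S_k) f :
    tree_sym (Node (sm_act d s) f) (Node d (fun i => f (s^-1%g i)))
| tree_sym_above k (d : M k) f g i :
    (forall j, j != i -> f j = g j) ->
    tree_sym (f i) (g i) ->
    tree_sym (Node d f) (Node d g).

Inductive tree_rel (K : fieldType) (M : smodule K) (n : nat) :
    {freeg (ntree M n) / K} -> Prop :=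
| tree_rel_lin a (t u v : ntree M n) :
    tree_lin a t u v -> tree_rel (<< t >> - (a *: << u >> + << v >>))
| tree_rel_sym (t u : ntree M n) :
    tree_sym t u -> tree_rel (<< t >> - << u >>).

Definition free_sort (K : fieldType) (M : smodule K) (n : nat) : lmodType K :=
  lquot (span (@tree_rel K M n)).

Definition tree_class (K : fieldType) (M : smodule K) (n : nat) (t : ntree M n) :
  free_sort M n := lpi (span (@tree_rel K M n)) << t >>.

Lemma freegUZ (K : fieldType) (T : choiceType) (c : K) (x : T) :
  << c *g x >> = c *: << x >>.
Proof.
by apply/eqP/freeg_eqP => y; rewrite coeffZ !coeffU mul1r.
Qed.

Lemma freeg_ind (K : fieldType) (T : choiceType) (Q : {freeg T / K} -> Prop) :
  Q 0 -> (forall c x D, Q D -> Q (c *: << x >> + D)) -> forall D, Q D.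
Proof.
move=> Q0 QD D; rewrite -(freeg_sumE D).
elim: (dom D) => [|x s IH]; first by rewrite big_nil.
by rewrite big_cons freegUZ; apply: QD.
Qed.

Lemma linear_freeg_ext (K : fieldType) (T : choiceType) (W : lmodType K)
  (f g : {freeg T / K} -> W) : linear f -> linear g ->
  (forall x, f << x >> = g << x >>) -> f =1 g.
Proof.
move=> Lf Lg fg; apply: freeg_ind => [|c x D IH].
  by rewrite (linear_sub0 Lf).2 (linear_sub0 Lg).2.
by rewrite Lf Lg fg IH.
Qed.

Lemma fglift_linear (K : fieldType) (T : choiceType) (W : lmodType K)
  (f : T -> W) : linear (fglift f : {freeg T / K} -> W).
Proof.
have fB := @lift_is_additive K T W f.
have f0 : fglift f 0 = 0 by rewrite -(subrr 0) fB subrr.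
have fD u v : fglift f (u + v) = fglift f u + fglift f v.
  by rewrite -{1}(opprK v) fB -(sub0r v) fB f0 sub0r opprK.
move=> a u v; rewrite fD; congr (_ + _); move: u.
apply: freeg_ind => [|c x D IH]; first by rewrite scaler0 f0 scaler0.
rewrite scalerDr !fD scalerDr IH; congr (_ + _).
by rewrite scalerA -!freegUZ !liftU scalerA.
Qed.

Definition tree_respects (K : fieldType) (M : smodule K) n (W : lmodType K)
    (f : ntree M n -> W) : Prop :=
  (forall a (t u v : ntree M n), tree_lin a t u v -> f t = a *: f u + f v) /\
  (forall t u : ntree M n, tree_sym t u -> f t = f u).

Definition free_lift (K : fieldType) (M : smodule K) n (W : lmodType K)
    (f : ntree M n -> W) : free_sort M n -> W :=
  @qlift K _ W (span (@tree_rel K M n)) (fglift f).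

Lemma fglift_rel (K : fieldType) (M : smodule K) n (W : lmodType K)
  (f : ntree M n -> W) : tree_respects f ->
  forall v, span (@tree_rel K M n) v -> fglift f v = 0.
Proof.
case=> flin fsym; apply: linear_span0; first exact: fglift_linear.
have L := fglift_linear f.
move=> _ [a t u v /flin E|t u /fsym E]; rewrite (linear_sub0 L).1 ?L !liftU.
  by rewrite !scale1r E subrr.
by rewrite !scale1r E subrr.
Qed.

Lemma free_liftE (K : fieldType) (M : smodule K) n (W : lmodType K)
  (f : ntree M n -> W) (t : ntree M n) :
  tree_respects f -> free_lift f (tree_class t) = f t.
Proof.
move=> rf; rewrite /free_lift qliftE ?liftU ?scale1r //.
  exact: fglift_linear.
exact: fglift_rel.
Qed.

Lemma free_lift_linear (K : fieldType) (M : smodule K) n (W : lmodType K)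
  (f : ntree M n -> W) : tree_respects f -> linear (free_lift f).
Proof.
by move=> rf; apply: qlift_linear; [apply: fglift_linear | apply: fglift_rel].
Qed.

Lemma free_ext (K : fieldType) (M : smodule K) n (W : lmodType K)
  (f g : free_sort M n -> W) : linear f -> linear g ->
  (forall t, f (tree_class t) = g (tree_class t)) -> f =1 g.
Proof.
move=> Lf Lg fg x; rewrite -[x]lreprK.
pose p := lpi (span (@tree_rel K M n)).
have Lp : linear p by exact: lpi_linear.
apply: (@linear_freeg_ext K _ W (f \o p) (g \o p)) => //.
  by move=> a u v; rewrite /= Lp Lf.
by move=> a u v; rewrite /= Lp Lg.
Qed.

Lemma tree_class_lin (K : fieldType) (M : smodule K) n a (t u v : ntree M n) :
  tree_lin a t u v -> tree_class t = a *: tree_class u + tree_class v.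
Proof.
move=> H; rewrite /tree_class -lpiZ -lpiD; apply/lpiP.
exact: mem_span (tree_rel_lin H).
Qed.

Lemma tree_class_sym (K : fieldType) (M : smodule K) n (t u : ntree M n) :
  tree_sym t u -> tree_class t = tree_class u.
Proof. by move=> H; apply/lpiP; apply: mem_span (tree_rel_sym H). Qed.

Lemma ntree_eq (K : fieldType) (M : smodule K) n (t u : ntree M n) :
  tree_of t = tree_of u -> t = u.
Proof.
case: t u => [t wt] [u wu] /= E; move: wt wu; rewrite E => wt wu.
by congr NTree; apply: bool_irrelevance.
Qed.

Lemma leaves_subst (K : fieldType) (M : smodule K) (g : nat -> tree M) t :
  leaves (subst_leaves g t) = flatten [seq leaves (g l) | l <- leaves t].
Proof.
elim: t => [l|k d f IH] /=; first by rewrite cats0.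
by elim: (enum _) => //= i s IHs; rewrite map_cat flatten_cat IHs IH.
Qed.

Lemma leaves_relabel (K : fieldType) (M : smodule K) h (t : tree M) :
  leaves (relabel h t) = [seq h l | l <- leaves t].
Proof. by rewrite leaves_subst; elim: (leaves t) => //= l s ->. Qed.

Lemma subst_leavesA (K : fieldType) (M : smodule K) (g h : nat -> tree M) t :
  subst_leaves h (subst_leaves g t)
    = subst_leaves (fun l => subst_leaves h (g l)) t.
Proof.
by elim: t => //= k d f IH; congr Node; apply/funext => i; apply: IH.
Qed.

Lemma subst_leaves_ext (K : fieldType) (M : smodule K) (g h : nat -> tree M) t :
  {in leaves t, g =1 h} -> subst_leaves g t = subst_leaves h t.
Proof.
elim: t => [l|k d f IH] /= E; first by apply: E; rewrite inE.
congr Node; apply/funext => i; apply: IH => l li; apply: E.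
by apply/flattenP; exists (leaves (f i)) => //; apply: map_f; rewrite mem_enum.
Qed.

Lemma subst_leaves_id (K : fieldType) (M : smodule K) (t : tree M) :
  subst_leaves Leaf t = t.
Proof.
by elim: t => //= k d f IH; congr Node; apply/funext => i; apply: IH.
Qed.

Lemma subst_lin (K : fieldType) (M : smodule K) (g : nat -> tree M) a t u v :
  tree_lin a t u v ->
  tree_lin a (subst_leaves g t) (subst_leaves g u) (subst_leaves g v).
Proof.
elim=> [k d d' f|k d f f1 f2 i E _ IH] /=; first exact: tree_lin_root.
by apply: (@tree_lin_above _ _ _ _ _ _ _ _ i) => // j /E [<- <-].
Qed.

Lemma subst_sym (K : fieldType) (M : smodule K) (g : nat -> tree M) t u :
  tree_sym t u -> tree_sym (subst_leaves g t) (subst_leaves g u).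
Proof.
elim=> [k d s f|k d f f1 i E _ IH] /=; first exact: tree_sym_root.
by apply: (@tree_sym_above _ _ _ _ _ _ i) => // j /E <-.
Qed.

Lemma uniq_flatten_disjoint (I : eqType) (F : I -> seq nat) (s : seq I) i j l :
  uniq (flatten [seq F x | x <- s]) -> i \in s -> j \in s -> j != i ->
  l \in F i -> l \notin F j.
Proof.
elim: s => //= x s IH; rewrite cat_uniq => /and3P [_ /hasPn dis us].
have no y : y \in s -> l \in F y -> l \notin F x.
  by move=> ys ly; apply: dis; apply/flattenP; exists (F y) => //; apply: map_f.
rewrite !inE => /orP [/eqP -> | si] /orP [/eqP -> | sj] ji li.
- by rewrite eqxx in ji.
- by apply/negP => lj; move: (no _ sj lj); rewrite li.
- exact: no si li.
- exact: IH.
Qed.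

Lemma uniq_flatten_sub (I : eqType) (F : I -> seq nat) (s : seq I) i :
  uniq (flatten [seq F x | x <- s]) -> i \in s -> uniq (F i).
Proof.
elim: s => //= x s IH; rewrite cat_uniq => /and3P [ux _ us].
by rewrite inE => /orP [/eqP ->|/(IH us)].
Qed.

Lemma graft_lin (K : fieldType) (M : smodule K) a l (g g1 g2 : nat -> tree M) t :
  (forall l', l' != l -> g l' = g1 l' /\ g l' = g2 l') ->
  tree_lin a (g l) (g1 l) (g2 l) -> uniq (leaves t) -> l \in leaves t ->
  tree_lin a (subst_leaves g t) (subst_leaves g1 t) (subst_leaves g2 t).
Proof.
move=> E Hl; elim: t => [l'|k d f IH] /=; first by rewrite inE => _ /eqP <-.
move=> ut /flattenP [_ /mapP [i ie ->] li].
apply: (@tree_lin_above _ _ _ _ _ _ _ _ i) => [j ji|].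
  have nj : l \notin leaves (f j).
    apply: (uniq_flatten_disjoint ut ie _ ji li); exact: mem_enum.
  split; apply: subst_leaves_ext => l' l'j;
    by case: (E l') => //; apply: contraNneq nj => <-.
by apply: IH => //; apply: uniq_flatten_sub ut ie.
Qed.

Lemma graft_sym (K : fieldType) (M : smodule K) l (g g1 : nat -> tree M) t :
  (forall l', l' != l -> g l' = g1 l') ->
  tree_sym (g l) (g1 l) -> uniq (leaves t) -> l \in leaves t ->
  tree_sym (subst_leaves g t) (subst_leaves g1 t).
Proof.
move=> E Hl; elim: t => [l'|k d f IH] /=; first by rewrite inE => _ /eqP <-.
move=> ut /flattenP [_ /mapP [i ie ->] li].
apply: (@tree_sym_above _ _ _ _ _ _ i) => [j ji|].
  have nj : l \notin leaves (f j).
    apply: (uniq_flatten_disjoint ut ie _ ji li); exact: mem_enum.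
  apply: subst_leaves_ext => l' l'j.
  by apply: E; apply: contraNneq nj => <-.
by apply: IH => //; apply: uniq_flatten_sub ut ie.
Qed.

Lemma ntree_uniq (K : fieldType) (M : smodule K) n (t : ntree M n) :
  uniq (leaves t).
Proof. by rewrite (perm_uniq (ntree_labels t)) iota_uniq. Qed.

Lemma mem_ntree (K : fieldType) (M : smodule K) n (t : ntree M n) l :
  (l \in leaves t) = (l < n)%N.
Proof. by rewrite (perm_mem (ntree_labels t)) mem_iota. Qed.

Lemma perm_labelE n (s : 'S_n) (i : 'I_n) : perm_label s i = s i.
Proof. by rewrite /perm_label valK. Qed.

Lemma perm_label_perm n (s : 'S_n) :
  perm_eq [seq perm_label s l | l <- iota 0 n] (iota 0 n).
Proof.
rewrite -val_enum_ord -map_comp.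
have -> : [seq (perm_label s \o val) i | i <- enum 'I_n]
    = [seq val l | l <- [seq s i | i <- enum 'I_n]].
  rewrite -[RHS]map_comp; apply: eq_map => i /=; exact: perm_labelE.
apply: perm_map; apply: uniq_perm; rewrite ?enum_uniq //.
  by rewrite map_inj_uniq ?enum_uniq //; apply: perm_inj.
move=> i; rewrite mem_enum inE; apply/mapP; exists ((s^-1)%g i).
  by rewrite mem_enum.
by rewrite permKV.
Qed.

Lemma tree_act_labels (K : fieldType) (M : smodule K) n (s : 'S_n)
  (t : ntree M n) : perm_eq (leaves (tree_act s t)) (iota 0 n).
Proof.
rewrite leaves_relabel; apply: perm_trans (perm_map _ (ntree_labels t)) _.
exact: perm_label_perm.
Qed.

Definition ntree_act (K : fieldType) (M : smodule K) n (s : 'S_n)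
  (t : ntree M n) : ntree M n := NTree (tree_act_labels s t).

Lemma tree_graft_labels (K : fieldType) (M : smodule K) m n (i : 'I_m)
  (t : ntree M m) (s : ntree M n) :
  perm_eq (leaves (tree_graft i n t s)) (iota 0 (m + n).-1).
Proof.
rewrite leaves_subst; set F := (X in map X _).
have := perm_flatten (perm_map F (ntree_labels t)) => /perm_trans; apply.
have Em : m = (i + (1 + (m - i.+1)))%N by have := ltn_ord i; lia.
have -> : iota 0 m = iota 0 i ++ [:: val i] ++ iota i.+1 (m - i.+1).
  by rewrite {1}Em !iotaD !add0n addn1.
have -> : (m + n).-1 = (i + (n + (m - i.+1)))%N by have := ltn_ord i; lia.
rewrite !map_cat !flatten_cat !iotaD !add0n /= cats0.
apply: perm_cat; last apply: perm_cat.
- have -> : [seq F l | l <- iota 0 i] = [seq [:: l] | l <- iota 0 i].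
    apply/eq_in_map => l; rewrite mem_iota /= add0n /F => li.
    by rewrite ltn_eqF //= /opos li.
  by rewrite flatten_seq1.
- rewrite /F eqxx leaves_relabel.
  apply: perm_trans (perm_map _ (ntree_labels s)) _.
  by rewrite -iotaDl addn0.
- have -> : iota (i + n) (m - i.+1)
      = [seq (l + n).-1 | l <- iota i.+1 (m - i.+1)].
    apply: (@eq_from_nth _ 0%N); rewrite ?size_map ?size_iota // => x xs.
    by rewrite (nth_map 0%N) ?size_iota // !nth_iota //; lia.
  rewrite -[X in perm_eq _ X]flatten_seq1 -map_comp.
  set G := (X in perm_eq _ (flatten X)).
  suff -> : [seq F l | l <- iota i.+1 (m - i.+1)] = G by [].
  apply/eq_in_map => l; rewrite mem_iota /F => /andP [il _].
  by rewrite gtn_eqF //= /opos ifN //; lia.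
Qed.

Definition ntree_graft (K : fieldType) (M : smodule K) m n (i : 'I_m)
  (t : ntree M m) (s : ntree M n) : ntree M (m + n).-1 :=
  NTree (tree_graft_labels i t s).

Lemma act_respects (K : fieldType) (M : smodule K) n (s : 'S_n) :
  tree_respects (fun t : ntree M n => tree_class (ntree_act s t)).
Proof.
split=> [a t u v H|t u H].
  by apply: tree_class_lin; apply: subst_lin.
by apply: tree_class_sym; apply: subst_sym.
Qed.

Definition free_act (K : fieldType) (M : smodule K) n (x : free_sort M n)
  (s : 'S_n) : free_sort M n :=
  free_lift (fun t => tree_class (ntree_act s t)) x.

Lemma free_actE (K : fieldType) (M : smodule K) n (t : ntree M n) s :
  free_act (tree_class t) s = tree_class (ntree_act s t).
Proof. exact: free_liftE t (act_respects M s). Qed.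

Lemma free_act_linear (K : fieldType) (M : smodule K) n (s : 'S_n) :
  linear (fun x : free_sort M n => free_act x s).
Proof. exact: free_lift_linear (act_respects M s). Qed.

Lemma graft_respects (K : fieldType) (M : smodule K) m n (i : 'I_m)
  (t : ntree M m) :
  tree_respects (fun s : ntree M n => tree_class (ntree_graft i t s)).
Proof.
split=> [a s u v H|s u H].
  apply: tree_class_lin; apply: (graft_lin (l := i));
    rewrite ?ntree_uniq ?mem_ntree //.
    by move=> l /negPf ->.
  by rewrite eqxx; apply: subst_lin.
apply: tree_class_sym; apply: (graft_sym (l := i));
  rewrite ?ntree_uniq ?mem_ntree //.
  by move=> l /negPf ->.
by rewrite eqxx; apply: subst_sym.
Qed.

Lemma lin_comb (K : fieldType) (U W : lmodType K) (a : K) (f g : U -> W) :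
  linear f -> linear g -> linear (fun x => a *: f x + g x).
Proof.
move=> Lf Lg b x y; rewrite Lf Lg !scalerDr !scalerA [a * b]mulrC.
by rewrite addrACA.
Qed.

Lemma insert_respects (K : fieldType) (M : smodule K) m n (i : 'I_m)
  (q : free_sort M n) : tree_respects (fun t : ntree M m =>
    free_lift (fun s : ntree M n => tree_class (ntree_graft i t s)) q).
Proof.
split=> [a t u v H|t u H]; move: q.
  apply: free_ext; first by apply: free_lift_linear; exact: graft_respects.
    by apply: lin_comb; apply: free_lift_linear; apply: graft_respects.
  move=> s; rewrite !free_liftE; try exact: graft_respects.
  by apply: tree_class_lin; apply: subst_lin.
apply: free_ext; try (apply: free_lift_linear; exact: graft_respects).
move=> s; rewrite !free_liftE; try exact: graft_respects.
by apply: tree_class_sym; apply: subst_sym.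
Qed.

Definition free_comp (K : fieldType) (M : smodule K) m n (i : 'I_m)
    (p : free_sort M m) (q : free_sort M n) : free_sort M (m + n).-1 :=
  free_lift (fun t : ntree M m =>
    free_lift (fun s : ntree M n => tree_class (ntree_graft i t s)) q) p.

Lemma free_compE (K : fieldType) (M : smodule K) m n (i : 'I_m)
  (t : ntree M m) (s : ntree M n) :
  free_comp i (tree_class t) (tree_class s) = tree_class (ntree_graft i t s).
Proof.
rewrite /free_comp free_liftE ?free_liftE //; first exact: graft_respects.
exact: insert_respects.
Qed.

Lemma free_comp_linl (K : fieldType) (M : smodule K) m n (i : 'I_m)
  (q : free_sort M n) : linear (fun p => free_comp i p q).
Proof. exact: free_lift_linear (insert_respects i q). Qed.

Lemma free_comp_linr (K : fieldType) (M : smodule K) m n (i : 'I_m)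
  (p : free_sort M m) : linear (fun q : free_sort M n => free_comp i p q).
Proof.
move=> a x y; move: p; apply: free_ext; first exact: free_comp_linl.
  by apply: lin_comb; apply: free_comp_linl.
move=> t; rewrite /free_comp !free_liftE; try exact: insert_respects.
apply: free_lift_linear; exact: graft_respects.
Qed.

Ltac opos_lia :=
  repeat match goal with
  | |- context [if ?b then _ else _] =>
      lazymatch b with
      | context [if _ then _ else _] => fail
      | _ => let H := fresh in have [H|H] := boolP b
      end
  end; lia.

Lemma perm_labelV n (s : 'S_n) (x : nat) (y : 'I_n) :
  s y = x :> nat -> perm_label s^-1%g x = y.
Proof. by move=> <-; rewrite perm_labelE permK. Qed.

Lemma tree_eqP (K : fieldType) (M : smodule K) n (t u : ntree M n) :
  tree_of t = tree_of u -> tree_class t = tree_class u.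
Proof. by move=> /ntree_eq ->. Qed.

Lemma free_act1 (K : fieldType) (M : smodule K) n (x : free_sort M n) :
  free_act x 1%g = x.
Proof.
move: x; apply: free_ext => // [|t]; first exact: free_act_linear.
rewrite free_actE; apply: tree_eqP => /=.
rewrite -[RHS]subst_leaves_id; apply: subst_leaves_ext => l.
rewrite mem_ntree => ln; congr Leaf.
by apply: (@perm_labelV n _ l (Ordinal ln)); rewrite perm1.
Qed.

Lemma free_actM (K : fieldType) (M : smodule K) n (x : free_sort M n)
  (s t : 'S_n) : free_act (free_act x s) t = free_act x (t * s)%g.
Proof.
move: x; apply: free_ext.
- by move=> a x y; rewrite !free_act_linear.
- exact: free_act_linear.
move=> u; rewrite !free_actE; apply: tree_eqP => /=.
rewrite /tree_act /relabel subst_leavesA; apply: subst_leaves_ext => l.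
rewrite mem_ntree => ln /=; congr Leaf.
rewrite -[l]/(val (Ordinal ln)) !perm_labelE.
by rewrite invMg permM.
Qed.

Definition free_smodule (K : fieldType) (M : smodule K) : smodule K :=
  Smodule (@free_act_linear K M) (@free_act1 K M) (@free_actM K M).

Lemma leaf_labels (K : fieldType) (M : smodule K) :
  perm_eq (leaves (Leaf 0 : tree M)) (iota 0 1).
Proof. by []. Qed.

Definition free_id (K : fieldType) (M : smodule K) : free_sort M 1 :=
  tree_class (NTree (leaf_labels M)).

Lemma ecast_tree_class (K : fieldType) (M : smodule K) m n (e : m = n)
  (t : ntree M m) (u : ntree M n) : tree_of t = tree_of u ->
  ecast k (free_sort M k) e (tree_class t) = tree_class u.
Proof. by case: n / e u => u /= /tree_eqP. Qed.

Lemma ecast_linear (K : fieldType) (M : smodule K) m n (e : m = n)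
  (U : lmodType K) (f : U -> free_sort M m) : linear f ->
  linear (fun x => ecast k (free_sort M k) e (f x)).
Proof. by case: n / e. Qed.

Lemma free_comp1p (K : fieldType) (M : smodule K) n (q : free_sort M n) :
  free_comp (ord0 : 'I_1) (free_id M) q = q.
Proof.
move: q; apply: free_ext => // [|s]; first exact: free_comp_linr.
rewrite free_compE; apply: tree_eqP => /=.
rewrite -[RHS]subst_leaves_id /tree_graft /= /relabel.
by apply: subst_leaves_ext.
Qed.

Lemma free_compp1 (K : fieldType) (M : smodule K) m (i : 'I_m)
  (p : free_sort M m) (e : (m + 1).-1 = m) :
  ecast k (free_sort M k) e (free_comp i p (free_id M)) = p.
Proof.
move: p; apply: free_ext => // [|t].
  by apply: ecast_linear; apply: free_comp_linl.
rewrite free_compE; apply: ecast_tree_class => /=.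
rewrite -[RHS]subst_leaves_id; apply: subst_leaves_ext => l _ /=.
case: eqP => [->|li]; first by rewrite /relabel /= addn0.
by rewrite /opos addn1; case: ltnP.
Qed.

Lemma free_comp_seq (K : fieldType) (M : smodule K) l m n (i : 'I_l) (j : 'I_m)
  (ij : 'I_(l + m).-1) (p : free_sort M l) (q : free_sort M m)
  (r : free_sort M n) (e : ((l + m).-1 + n).-1 = (l + (m + n).-1).-1) :
  ij = (i + j)%N :> nat ->
  ecast k (free_sort M k) e (free_comp ij (free_comp i p q) r)
    = free_comp i p (free_comp j q r).
Proof.
move=> Eij; move: p; apply: free_ext.
- by apply: ecast_linear => a x y; rewrite !free_comp_linl.
- exact: free_comp_linl.
move=> t; move: q; apply: free_ext.
- by apply: ecast_linear => a x y; rewrite free_comp_linr free_comp_linl.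
- by move=> a x y; rewrite free_comp_linl free_comp_linr.
move=> u; move: r; apply: free_ext.
- by apply: ecast_linear; apply: free_comp_linr.
- by move=> a x y; rewrite !free_comp_linr.
move=> v; rewrite !free_compE; apply: ecast_tree_class => /=.
rewrite /tree_graft subst_leavesA; apply: subst_leaves_ext => x _.
have jm := ltn_ord j.
case: eqP => [_|xi].
  rewrite /relabel !subst_leavesA; apply: subst_leaves_ext => y _ /=.
  rewrite Eij eqn_add2l; case: eqP => [_|yj].
    rewrite subst_leavesA; apply: subst_leaves_ext => z _ /=.
    by rewrite addnA.
  by congr Leaf; rewrite /opos; opos_lia.
rewrite /= ifN; last by rewrite Eij /opos; opos_lia.
by congr Leaf; rewrite Eij /opos; opos_lia.
Qed.

Lemma free_comp_par (K : fieldType) (M : smodule K) l m n (i k : 'I_l)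
  (i' : 'I_(l + n).-1) (k' : 'I_(l + m).-1) (p : free_sort M l)
  (q : free_sort M m) (r : free_sort M n)
  (e : ((l + m).-1 + n).-1 = ((l + n).-1 + m).-1) :
  (i < k)%N -> i' = i :> nat -> k' = (k + m).-1 :> nat ->
  ecast k (free_sort M k) e (free_comp k' (free_comp i p q) r)
    = free_comp i' (free_comp k p r) q.
Proof.
move=> ik Ei Ek; move: p; apply: free_ext.
- by apply: ecast_linear => a x y; rewrite !free_comp_linl.
- by move=> a x y; rewrite !free_comp_linl.
move=> t; move: q; apply: free_ext.
- by apply: ecast_linear => a x y; rewrite free_comp_linr free_comp_linl.
- exact: free_comp_linr.
move=> u; move: r; apply: free_ext.
- by apply: ecast_linear; apply: free_comp_linr.
- by move=> a x y; rewrite free_comp_linr free_comp_linl.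
move=> v; rewrite !free_compE; apply: ecast_tree_class => /=.
rewrite /tree_graft !subst_leavesA; apply: subst_leaves_ext => x _.
case: eqP => [xi|xi].
  rewrite ifN ?xi /=; last by apply/eqP; lia.
  rewrite ifT; last by rewrite Ei /opos ik.
  rewrite /relabel subst_leavesA Ei; apply: subst_leaves_ext => y.
  rewrite mem_ntree => ym /=.
  rewrite ifN; last by rewrite Ek; lia.
  by congr Leaf; rewrite /opos Ek; opos_lia.
rewrite /=; case: (eqVneq x (k : nat)) => [->|xk].
  rewrite ifT; last by rewrite Ek /opos; opos_lia.
  rewrite /relabel subst_leavesA Ek; apply: subst_leaves_ext => y _ /=.
  rewrite ifN; last by rewrite Ei; lia.
  by congr Leaf; rewrite /opos Ei; opos_lia.
rewrite /= !ifN; first last.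
- by rewrite Ek /opos; opos_lia.
- by rewrite Ei /opos; opos_lia.
by congr Leaf; rewrite Ek Ei /opos; opos_lia.
Qed.

Lemma opos_lt m n (i j : 'I_m) : j != i -> (opos i n j < (m + n).-1)%N.
Proof.
rewrite -val_eqE /= => ji.
by have := ltn_ord i; have := ltn_ord j; rewrite /opos; opos_lia.
Qed.

Lemma add_lt m n (i : 'I_m) (j : 'I_n) : (i + j < (m + n).-1)%N.
Proof. by have := ltn_ord i; have := ltn_ord j; lia. Qed.

Lemma free_comp_actl (K : fieldType) (M : smodule K) m n (i : 'I_m) (s : 'S_m)
  (tau : 'S_(m + n).-1) (p : free_sort M m) (q : free_sort M n) :
  perm_outer i s tau ->
  free_comp i (free_act p s) q = free_act (free_comp (s i) p q) tau.
Proof.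
case=> tau1 tau2; move: p; apply: free_ext.
- by move=> a x y; rewrite free_act_linear free_comp_linl.
- by move=> a x y; rewrite free_comp_linl free_act_linear.
move=> t; move: q; apply: free_ext.
- exact: free_comp_linr.
- by move=> a x y; rewrite free_comp_linr free_act_linear.
move=> u; rewrite !(free_compE, free_actE); apply: tree_eqP => /=.
rewrite /tree_act /tree_graft /relabel !subst_leavesA.
apply: subst_leaves_ext => x; rewrite mem_ntree => xm /=.
have [y ->] : exists y : 'I_m, x = s y.
  by exists (s^-1%g (Ordinal xm)); rewrite permKV.
rewrite perm_labelE permK !val_eqE (inj_eq perm_inj).
have [_|yi] := eqVneq y i => /=.
  rewrite subst_leavesA; apply: subst_leaves_ext => z.
  rewrite mem_ntree => zn; congr Leaf; apply/esym.
  apply: (perm_labelV (y := Ordinal (add_lt i (Ordinal zn)))).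
  exact: (tau2 (Ordinal zn)).
congr Leaf; apply/esym.
by apply: (perm_labelV (y := Ordinal (opos_lt n yi))); apply: tau1.
Qed.

Lemma free_comp_actr (K : fieldType) (M : smodule K) m n (i : 'I_m) (s : 'S_n)
  (tau : 'S_(m + n).-1) (p : free_sort M m) (q : free_sort M n) :
  perm_inner i s tau ->
  free_comp i p (free_act q s) = free_act (free_comp i p q) tau.
Proof.
case=> tau1 tau2; move: p; apply: free_ext.
- exact: free_comp_linl.
- by move=> a x y; rewrite free_comp_linl free_act_linear.
move=> t; move: q; apply: free_ext.
- by move=> a x y; rewrite free_act_linear free_comp_linr.
- by move=> a x y; rewrite free_comp_linr free_act_linear.
move=> u; rewrite !(free_compE, free_actE); apply: tree_eqP => /=.
rewrite /tree_act /tree_graft /relabel !subst_leavesA.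
apply: subst_leaves_ext => x; rewrite mem_ntree => xm /=.
case: eqP => [xi|/eqP xi].
  rewrite !subst_leavesA; apply: subst_leaves_ext => z.
  rewrite mem_ntree => zn; congr Leaf; apply/esym.
  have [y ->] : exists y : 'I_n, z = s y.
    by exists (s^-1%g (Ordinal zn)); rewrite permKV.
  rewrite perm_labelE permK.
  by apply: (perm_labelV (y := Ordinal (add_lt i y))); apply: tau2.
congr Leaf; apply/esym.
have xi' : Ordinal xm != i by [].
by apply: (perm_labelV (y := Ordinal (opos_lt n xi'))); apply: (tau1 (Ordinal xm)).
Qed.

Definition free_operad (K : fieldType) (M : smodule K) : operad K :=
  @Operad K (free_smodule M) (free_id M) (@free_comp K M)
    (@free_comp_linl K M) (@free_comp_linr K M) (@free_comp1p K M)
    (@free_compp1 K M) (@free_comp_seq K M) (@free_comp_par K M)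
    (@free_comp_actl K M) (@free_comp_actr K M).

(* The splitting is applied to a formal combination of trees term by term, so  *)
(* the relators are kept as such, not as elements of the free operad.          *)
Definition tree_expr (K : fieldType) (M : smodule K) (n : nat) :=
  seq (K * ntree M n).

Definition expr_class (K : fieldType) (M : smodule K) (n : nat)
  (r : tree_expr M n) : free_operad M n :=
  \sum_(ct <- r) ct.1 *: (tree_class ct.2 : free_operad M n).

Record presentation (K : fieldType) := Presentation {
  generators : smodule K;
  relators : forall n, tree_expr generators n -> Prop
}.

Inductive relator_class (K : fieldType) (Q : presentation K) :
    forall n, free_operad (generators Q) n -> Prop :=
| RelatorClass n (r : tree_expr (generators Q) n) :
    relators r -> relator_class (expr_class r).

Definition relation_ideal (K : fieldType) (Q : presentation K) :
  ideal (free_operad (generators Q)) := gen_ideal (relator_class (Q := Q)).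

Definition presented_operad (K : fieldType) (Q : presentation K) : operad K :=
  quotient_operad (relation_ideal Q).

(* M(n) (x) (K e_1 + ... + K e_n) is realized as the module of functions from  *)
(* 'I_n to M(n); binom w j is w (x) e_j.                                       *)
Definition asp_sort (K : fieldType) (M : smodule K) (n : nat) : lmodType K :=
  {ffun 'I_n -> M n}.

Definition asp_act (K : fieldType) (M : smodule K) (n : nat)
  (F : asp_sort M n) (s : 'S_n) : asp_sort M n :=
  [ffun j => sm_act ((F : {ffun 'I_n -> M n}) (s j)) s].

Lemma asp_act_linear (K : fieldType) (M : smodule K) n (s : 'S_n) :
  linear (fun F : asp_sort M n => asp_act F s).
Proof.
move=> a F G; apply/ffunP => j; rewrite !ffunE.
by rewrite (sm_act_linear s a).
Qed.

Lemma asp_act1 (K : fieldType) (M : smodule K) n (F : asp_sort M n) :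
  asp_act F 1%g = F.
Proof. by apply/ffunP => j; rewrite !ffunE sm_act1 perm1. Qed.

Lemma asp_actM (K : fieldType) (M : smodule K) n (F : asp_sort M n)
  (s t : 'S_n) : asp_act (asp_act F s) t = asp_act F (t * s)%g.
Proof. by apply/ffunP => j; rewrite !ffunE sm_actM permM. Qed.

Definition ASp_smodule (K : fieldType) (M : smodule K) : smodule K :=
  Smodule (@asp_act_linear K M) (@asp_act1 K M) (@asp_actM K M).

Definition binom (K : fieldType) (M : smodule K) n (w : M n) (j : 'I_n) :
  ASp_smodule M n := [ffun i => if i == j then w else 0].

Definition binom_star (K : fieldType) (M : smodule K) n (w : M n) :
  ASp_smodule M n := \sum_(j < n) binom w j.

Lemma binom_act (K : fieldType) (M : smodule K) n (w : M n) (j : 'I_n)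
  (s : 'S_n) : sm_act (binom w j) s = binom (sm_act w s) (s^-1%g j).
Proof.
apply/ffunP => i; rewrite !ffunE.
rewrite -(inj_eq (@perm_inj _ s) i) permKV; case: eqP => // _.
exact: (linear_sub0 (sm_act_linear s)).2.
Qed.

(* When the labels of the leaves are pairwise distinct, at most one input of a *)
(* vertex lies below the leaf j.                                               *)
Fixpoint ASp_tree (K : fieldType) (M : smodule K) (j : nat) (t : tree M) :
    tree (ASp_smodule M) :=
  match t with
  | Leaf l => Leaf l
  | Node _ w f =>
      Node (if [pick i | j \in leaves (f i)] is Some i then binom w i
            else binom_star w)
           (fun i => ASp_tree j (f i))
  end.

Lemma leaves_ASp_tree (K : fieldType) (M : smodule K) j (t : tree M) :
  leaves (ASp_tree j t) = leaves t.
Proof.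
elim: t => //= k w f IH; congr flatten.
by apply/eq_in_map => i _; apply: IH.
Qed.

Lemma ASp_labels (K : fieldType) (M : smodule K) n (j : 'I_n) (t : ntree M n) :
  perm_eq (leaves (ASp_tree j t)) (iota 0 n).
Proof. by rewrite leaves_ASp_tree ntree_labels. Qed.

Definition ASp_ntree (K : fieldType) (M : smodule K) n (j : 'I_n)
  (t : ntree M n) : ntree (ASp_smodule M) n := NTree (ASp_labels j t).

Definition ASp_expr (K : fieldType) (M : smodule K) n (j : 'I_n)
  (r : tree_expr M n) : tree_expr (ASp_smodule M) n :=
  [seq (ct.1, ASp_ntree j ct.2) | ct <- r].

Inductive ASp_relators (K : fieldType) (Q : presentation K) :
    forall n, tree_expr (ASp_smodule (generators Q)) n -> Prop :=
| ASpRelator n (r : tree_expr (generators Q) n) (j : 'I_n) :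
    relators r -> ASp_relators (ASp_expr j r).

Definition ASp (K : fieldType) (Q : presentation K) : presentation K :=
  Presentation (@ASp_relators K Q).

(* The number of rows (n == 3) is 1 for n = 3 and 0 otherwise, so that E(3) is *)
(* the module of row vectors of length 3 and E(n) = 0 for n != 3.              *)
Definition E_sort (K : fieldType) (n : nat) : lmodType K := 'M[K]_(n == 3, n).

Definition E_act (K : fieldType) (n : nat) (v : E_sort K n) (s : 'S_n) :
  E_sort K n := (-1) ^+ s *: col_perm s v.

Lemma E_act_linear (K : fieldType) n (s : 'S_n) :
  linear (fun v : E_sort K n => E_act v s).
Proof.
by move=> a u v; apply/matrixP => i j; rewrite !mxE; rewrite mulrDr mulrCA.
Qed.

Lemma E_act1 (K : fieldType) n (v : E_sort K n) : E_act v 1%g = v.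
Proof. by rewrite /E_act odd_perm1 scale1r col_perm1. Qed.

Lemma E_actM (K : fieldType) n (v : E_sort K n) (s t : 'S_n) :
  E_act (E_act v s) t = E_act v (t * s)%g.
Proof.
apply/matrixP => i j; rewrite !mxE permM mulrA odd_permM signr_addb.
by [].
Qed.

Definition E (K : fieldType) : smodule K :=
  Smodule (@E_act_linear K) (@E_act1 K) (@E_actM K).

Definition X (K : fieldType) (i : 'I_3) : E K 3 :=
  (delta_mx 0 i : 'M[K]_(1, 3)).

Lemma X_act (K : fieldType) (i : 'I_3) (s : 'S_3) :
  sm_act (X K i) s = (-1) ^+ s *: X K (s^-1%g i).
Proof.
rewrite /= /E_act; congr (_ *: _); apply/matrixP => a b; rewrite !mxE.
by rewrite -(inj_eq (@perm_inj _ s) b) permKV.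
Qed.

(* X_1, X_2, X_3 are X 0, X 1, X 2, and the variable x_i is the leaf i - 1.    *)
Definition X_tree (K : fieldType) (i : 'I_3) (a b c : tree (E K)) : tree (E K) :=
  Node (X K i) (fun j : 'I_3 => nth a [:: a; b; c] j).

Lemma leaves_X_tree (K : fieldType) (i : 'I_3) (a b c : tree (E K)) :
  leaves (X_tree i a b c) = leaves a ++ leaves b ++ leaves c.
Proof.
rewrite /= !enum_ordSl /=.
by rewrite (size0nil (size_enum_ord 0)) /= cats0.
Qed.

Section Relators.
Variable K : fieldType.

Local Notation ntree_of n t := (@NTree K (E K) n t
  ltac:(by rewrite ?leaves_X_tree)) (only parsing).
Local Notation x_ i := (Leaf i.-1) (only parsing).
Local Notation "'X1" := (@X_tree K 0) (only parsing).
Local Notation "'X2" := (@X_tree K 1) (only parsing).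
Local Notation "'X3" := (@X_tree K 2) (only parsing).

Definition r1 : tree_expr (E K) 3 :=
  [:: (1, ntree_of 3 ('X1 (x_ 1) (x_ 2) (x_ 3)));
      (1, ntree_of 3 ('X2 (x_ 1) (x_ 2) (x_ 3)));
      (1, ntree_of 3 ('X3 (x_ 1) (x_ 2) (x_ 3)))].

Definition r2 : tree_expr (E K) 5 :=
  [:: (1, ntree_of 5 ('X3 (x_ 1) (x_ 2) ('X3 (x_ 3) (x_ 4) (x_ 5))));
      (-1, ntree_of 5 ('X3 ('X3 (x_ 1) (x_ 2) (x_ 3)) (x_ 4) (x_ 5)));
      (-1, ntree_of 5 ('X3 (x_ 3) ('X3 (x_ 1) (x_ 2) (x_ 4)) (x_ 5)));
      (-1, ntree_of 5 ('X3 (x_ 3) (x_ 4) ('X3 (x_ 1) (x_ 2) (x_ 5))))].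

End Relators.

Inductive LTS_relators (K : fieldType) : forall n, tree_expr (E K) n -> Prop :=
| LTS_r1 : LTS_relators (r1 K)
| LTS_r2 : LTS_relators (r2 K).

Definition LTS_presentation (K : fieldType) : presentation K :=
  Presentation (@LTS_relators K).

Definition LTS (K : fieldType) : operad K :=
  presented_operad (LTS_presentation K).

Definition ASp_LTS_presentation (K : fieldType) : presentation K :=
  ASp (LTS_presentation K).

Definition ASp_LTS (K : fieldType) : operad K :=
  presented_operad (ASp_LTS_presentation K).

(* The leaves labelled 1 and 3 are the leaves 0 and 2 here.                    *)
Inductive preLTS_relators (K : fieldType) :
    forall n, tree_expr (ASp_smodule (E K)) n -> Prop :=
| preLTS_r1 (j : 'I_3) : preLTS_relators (ASp_expr j (r1 K))
| preLTS_r2_1 : preLTS_relators (ASp_expr (0 : 'I_5) (r2 K))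
| preLTS_r2_3 : preLTS_relators (ASp_expr (2 : 'I_5) (r2 K)).

Definition preLTS_presentation (K : fieldType) : presentation K :=
  Presentation (@preLTS_relators K).

Definition preLTS (K : fieldType) : operad K :=
  presented_operad (preLTS_presentation K).

(* Main.v *)
(* Write [r2] as [D [x3,x4,x5] - [D x3,x4,x5] - [x3,D x4,x5] - [x3,x4,D x5]]   *)
(* with [D = [x1,x2,-]], and let the index be the marked variable. By the      *)
(* antisymmetry of the bracket in its first two arguments, exchanging x1 and   *)
(* x2 turns ASp_1(r2) into - ASp_2(r2), and exchanging x3 and x4 turns         *)
(* ASp_3(r2) into - ASp_4(r2). With J the cyclic sum r1, the sum of r2 over    *)
(* the cyclic permutations of x3, x4, x5 is                                    *)
(* [D J(x3,x4,x5) - J(D x3,x4,x5) - J(x3,D x4,x5) - J(x3,x4,D x5)]. Marking x5 *)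
(* throughout, this expresses ASp_5(r2) modulo ASp(r1) through permuted copies *)
(* of ASp_3(r2) and ASp_4(r2).                                                 *)

Require Import Defs.
From mathcomp Require Import all_boot all_fingroup all_algebra.
From mathcomp Require Import boolp.

Set Implicit Arguments.
Unset Strict Implicit.
Unset Printing Implicit Defensive.

Import GRing.Theory.

Local Open Scope ring_scope.

(** One inclusion of ideals is immediate; for the other, only the splittings of [r2] marked at x2,
    x4 and x5 must be derived. The generators are already antisymmetric in [E], and this survives
    splitting with the mark following its leaf. Hence [r2] is skew in x1, x2 and in x3, x4 at the
    split level: the mark x1 yields x2 ([ASp_r2_2]) and x3 yields x4 ([ASp_r2_4]). For x5, [r2] says
    that D = [x1,x2,-] is a derivation. Its cyclic sum over x3, x4, x5 regroups into four Jacobi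
    sums, each a graft of the split [r1] with a corolla (the [jacobi_] lemmas). Two of the three
    summands are copies of the relators marked at x3 and x4, so the third lies in the ideal
    ([ASp_r2_5]). *)

(** * Classes of raw trees in the free operad *)

Section TreeClasses.
Variables (K : fieldType) (M : smodule K).
Implicit Types (t u v : tree M) (n : nat).

(* The junk value 0 on wrongly labelled trees makes the linearity and symmetry *)
(* rules below free of side conditions.                                        *)
Definition class_of n t : free_sort M n :=
  if @idP (perm_eq (leaves t) (iota 0 n)) is ReflectT h
  then tree_class (NTree h) else 0.

Lemma class_of_ntree n (t : ntree M n) : class_of n t = tree_class t.
Proof.
rewrite /class_of; case: {-}_ / idP => [h|]; first exact: tree_eqP.
by rewrite ntree_labels.
Qed.

Lemma class_of0 n t : ~ perm_eq (leaves t) (iota 0 n) -> class_of n t = 0.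
Proof. by rewrite /class_of; case: {-}_ / idP. Qed.

Lemma leaves_lin a t u v :
  tree_lin a t u v -> leaves t = leaves u /\ leaves t = leaves v.
Proof.
elim=> [//|k d f g h i fgh _ [IHg IHh]] /=.
split; congr flatten; apply: eq_map => j.
  by have [->//|/fgh []] := eqVneq j i => ->.
by have [->//|/fgh [_ ->]] := eqVneq j i.
Qed.

Lemma leaves_sym t u : tree_sym t u -> perm_eq (leaves t) (leaves u).
Proof.
elim=> [k d s f|k d f g i fg _ IH] /=.
  rewrite [X in perm_eq _ (flatten X)](_ : _ =
    [seq leaves (f i) | i <- [seq (s^-1)%g i | i <- enum 'I_k]]).
    apply/perm_flatten/perm_map; rewrite perm_sym; apply: uniq_perm; rewrite ?enum_uniq //.
      by rewrite map_inj_uniq ?enum_uniq //; apply: perm_inj.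
    move=> i; rewrite mem_enum inE; apply/mapP; exists (s i).
      by rewrite mem_enum.
    by rewrite permK.
  by rewrite -[RHS]map_comp.
elim: (enum _) => //= j s IHs; apply: perm_cat IHs.
by have [->//|/fg ->] := eqVneq j i.
Qed.

Lemma class_of_lin n a t u v :
  tree_lin a t u v -> class_of n t = a *: class_of n u + class_of n v.
Proof.
move=> L; have [Eu Ev] := leaves_lin L.
have [ht|ht] := pselect (is_true (perm_eq (leaves t) (iota 0 n))); last first.
  by rewrite !class_of0 -?Eu -?Ev // scaler0 addr0.
have hu := ht; rewrite Eu in hu; have hv := ht; rewrite Ev in hv.
rewrite -[t]/(tree_of (NTree ht)) -[u]/(tree_of (NTree hu)).
by rewrite -[v]/(tree_of (NTree hv)) !class_of_ntree; apply: tree_class_lin.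
Qed.

Lemma class_of_sym n t u : tree_sym t u -> class_of n t = class_of n u.
Proof.
move=> S; have E := leaves_sym S.
have [ht|ht] := pselect (is_true (perm_eq (leaves t) (iota 0 n))); last first.
  by rewrite !class_of0 // -(permPl E).
have hu := ht; rewrite (permPl E) in hu.
rewrite -[t]/(tree_of (NTree ht)) -[u]/(tree_of (NTree hu)).
by rewrite !class_of_ntree; apply: tree_class_sym.
Qed.

(** Lets an identity at one vertex be applied below other vertices, without writing the tree as a
    graft. *)
Definition tree_context (C : tree M -> tree M) : Prop :=
  (forall a t u v, tree_lin a t u v -> tree_lin a (C t) (C u) (C v)) /\
  (forall t u, tree_sym t u -> tree_sym (C t) (C u)).

Lemma context_id : tree_context id.
Proof. by []. Qed.

Lemma class_of_node_linear n C k (f : 'I_k -> tree M) :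
  tree_context C -> linear (fun d : M k => class_of n (C (Node d f))).
Proof.
by move=> [Clin _] a d d'; apply/class_of_lin/Clin/tree_lin_root.
Qed.

Lemma class_of_node_act n C k (d : M k) (s : 'S_k) (f : 'I_k -> tree M) :
  tree_context C ->
  class_of n (C (Node (sm_act d s) f))
    = class_of n (C (Node d (fun i => f (s^-1%g i)))).
Proof. by move=> [_ Csym]; apply/class_of_sym/Csym/tree_sym_root. Qed.

Definition node3 (w : M 3) (a b c : tree M) : tree M :=
  Node w (fun j : 'I_3 => nth a [:: a; b; c] j).

Lemma eq_node3 w (f : 'I_3 -> tree M) : Node w f = node3 w (f 0) (f 1) (f 2).
Proof.
congr Node; apply/funext => -[[|[|[|]]] //= h]; congr f; exact: val_inj.
Qed.

Lemma leaves_node3 w a b c :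
  leaves (node3 w a b c) = leaves a ++ leaves b ++ leaves c.
Proof.
rewrite /= !enum_ordSl /=.
by rewrite (size0nil (size_enum_ord 0)) /= cats0.
Qed.

Lemma subst_node3 g w a b c :
  subst_leaves g (node3 w a b c)
    = node3 w (subst_leaves g a) (subst_leaves g b) (subst_leaves g c).
Proof. exact: eq_node3. Qed.

Lemma context_node3_1 w a b : tree_context (fun t => node3 w t a b).
Proof.
split=> [x t u v L|t u S].
  by apply: (@tree_lin_above _ _ _ _ _ _ _ _ (0 : 'I_3)) => // -[[|[|[|]]]].
by apply: (@tree_sym_above _ _ _ _ _ _ (0 : 'I_3)) => // -[[|[|[|]]]].
Qed.

Lemma context_node3_2 w a b : tree_context (fun t => node3 w a t b).
Proof.
split=> [x t u v L|t u S].
  by apply: (@tree_lin_above _ _ _ _ _ _ _ _ (1 : 'I_3)) => // -[[|[|[|]]]].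
by apply: (@tree_sym_above _ _ _ _ _ _ (1 : 'I_3)) => // -[[|[|[|]]]].
Qed.

Lemma context_node3_3 w a b : tree_context (fun t => node3 w a b t).
Proof.
split=> [x t u v L|t u S].
  by apply: (@tree_lin_above _ _ _ _ _ _ _ _ (2 : 'I_3)) => // -[[|[|[|]]]].
by apply: (@tree_sym_above _ _ _ _ _ _ (2 : 'I_3)) => // -[[|[|[|]]]].
Qed.

Lemma relabel_perm n (h : nat -> nat) :
  perm_eq (map h (iota 0 n)) (iota 0 n) ->
  exists s : 'S_n, forall l, (l < n)%N -> perm_label s^-1%g l = h l.
Proof.
move=> hn; have h_lt (i : 'I_n) : (h i < n)%N.
  rewrite -[(_ < _)%N]/(0 <= h i < 0 + n)%N -mem_iota.
  by rewrite -(perm_mem hn) map_f // mem_iota ltn_ord.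
have h_inj : injective (fun i => Ordinal (h_lt i)).
  have : uniq (map h (iota 0 n)) by rewrite (perm_uniq hn) iota_uniq.
  move=> /(uniqP 0%N) U i j [] E; apply: val_inj.
  move: (U i j); rewrite !inE size_map size_iota !ltn_ord.
  by rewrite !(nth_map 0%N) ?size_iota // !nth_iota // !add0n => V; apply: V.
(* The action relabels leaves by the inverse permutation, hence the inverse here. *)
exists ((perm h_inj)^-1)%g => l ln; rewrite invgK.
by rewrite -[l]/(val (Ordinal ln)) perm_labelE permE.
Qed.

(** * Closure of ideals under relabelling and grafting *)

Section Closure.
Variable (I : ideal (free_operad M)).

Lemma expr_class_map m n (F : free_operad M m -> free_operad M n)
    (G : ntree M m -> ntree M n) (r : tree_expr M m) :
  linear F -> (forall t : ntree M m, F (tree_class t) = tree_class (G t)) ->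
  F (expr_class r) = expr_class [seq (ct.1, G ct.2) | ct <- r].
Proof.
move=> LF FG; rewrite /expr_class big_map.
elim: r => [|ct r IH]; first by rewrite !big_nil (linear_sub0 LF).2.
by rewrite !big_cons LF IH FG.
Qed.

(** With [h] a plain function on labels, a permutation can be given as a list and its side condition
    decided by computation. *)
Lemma ideal_relabel n (r : tree_expr M n) (h : nat -> nat) :
  perm_eq (map h (iota 0 n)) (iota 0 n) -> ideal_pred I (expr_class r) ->
  ideal_pred I (\sum_(ct <- r) ct.1 *: class_of n (relabel h ct.2)
    : free_operad M n).
Proof.
move=> /relabel_perm [s hs] /(ideal_act (svalP I) s).
rewrite (@expr_class_map n n (fun x => sm_act x s) (ntree_act s)); first last.
- by move=> t; apply: free_actE.
- exact: free_act_linear.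
rewrite /expr_class big_map.
congr ideal_pred; apply: eq_bigr => ct _; congr (_ *: _).
rewrite -class_of_ntree; congr class_of.
apply: subst_leaves_ext => l; rewrite mem_ntree => ln.
by rewrite hs.
Qed.

Lemma ideal_graft_outer m n (i : 'I_m) (r : tree_expr M m) (u : ntree M n) :
  ideal_pred I (expr_class r) ->
  ideal_pred I (expr_class [seq (ct.1, ntree_graft i ct.2 u) | ct <- r]).
Proof.
move=> /(ideal_compl (svalP I) i (tree_class u : free_operad M n)).
rewrite (@expr_class_map _ _ (fun p => op_comp i p _) (ntree_graft i ^~ u)) //.
  exact: free_comp_linl.
by move=> t; apply: free_compE.
Qed.

Lemma ideal_graft_inner m n (i : 'I_m) (t : ntree M m) (r : tree_expr M n) :
  ideal_pred I (expr_class r) ->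
  ideal_pred I (expr_class [seq (cu.1, ntree_graft i t cu.2) | cu <- r]).
Proof.
move=> /(ideal_compr (svalP I) i (tree_class t : free_operad M m)).
rewrite (@expr_class_map _ _ (fun q => op_comp i _ q) (ntree_graft i t)) //.
  exact: free_comp_linr.
by move=> u; apply: free_compE.
Qed.

Lemma idealD n (x y : free_operad M n) :
  ideal_pred I x -> ideal_pred I y -> ideal_pred I (x + y).
Proof. by move=> Ix Iy; rewrite -[x]scale1r; apply: (ideal_lin (svalP I)). Qed.

Lemma idealN n (x : free_operad M n) : ideal_pred I x -> ideal_pred I (- x).
Proof.
move=> Ix; rewrite -scaleN1r -[_ *: _]addr0.
by apply: (ideal_lin (svalP I)) => //; apply: (ideal0 (svalP I)).
Qed.

End Closure.
End TreeClasses.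

(** * Symmetries of the split bracket *)

Section Splitting.
Variable K : fieldType.
Notation AE := (ASp_smodule (E K)).
Implicit Types (a b c : tree AE).

Lemma binom_linear n (i : 'I_n) : linear (fun w : E K n => binom w i).
Proof.
move=> x u v; apply/ffunP => j; rewrite !ffunE.
by case: eqP => // _; rewrite scaler0 addr0.
Qed.

Lemma class_of_binom_act n C (i j : 'I_3) (s : 'S_3) (f : 'I_3 -> tree AE) :
  tree_context C ->
  class_of n (C (Node (binom (X K (s^-1%g i)) (s^-1%g j)) f))
    = (-1) ^+ s *: class_of n (C (Node (binom (X K i) j)
        (fun i => f (s^-1%g i)))).
Proof.
move=> HC; rewrite -(class_of_node_act n (binom (X K i) j) s f HC) binom_act X_act.
have L := class_of_node_linear n f HC.
have Z x (w : AE 3) : class_of n (C (Node (x *: w) f))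
    = x *: class_of n (C (Node w f)).
  by have := L x w 0; rewrite /= (linear_sub0 L).2 !addr0.
rewrite -[_ *: X K _]addr0 binom_linear (linear_sub0 (binom_linear _)).2 addr0.
(* The sign from [X_act] meets the sign of the statement and they cancel. *)
by rewrite Z scalerA -signr_addb addbb scale1r.
Qed.

(** Antisymmetry of the bracket: the mark moves with its argument from the first input to the
    second. *)
Lemma class_of_swap0 n C a b c : tree_context C ->
  class_of n (C (node3 (binom (X K 2) 0) a b c))
    = - class_of n (C (node3 (binom (X K 2) 1) b a c)).
Proof.
move=> HC; have := @class_of_binom_act n C 2 1 (tperm 0 1)
  (fun j => nth a [:: a; b; c] j) HC.
rewrite tpermV tpermR tpermD // odd_tperm /= expr1 scaleN1r => ->.
by rewrite eq_node3 tpermL tpermR tpermD.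
Qed.

(** The 3-cycle whose inverse is i -> i + 1 modulo 3; being even, it introduces no sign. *)
Definition rot3 : 'S_3 := (tperm 0%R 2%R * tperm 0%R 1%R)%g.

Lemma rot3V : [/\ rot3^-1%g 0 = 1, rot3^-1%g 1 = 2 & rot3^-1%g 2 = 0].
Proof.
split; apply: (@perm_inj _ rot3); rewrite permKV permM.
- by rewrite (tpermD (z := 1)) ?tpermR.
- by rewrite tpermR tpermL.
- by rewrite tpermL tpermD.
Qed.

Lemma class_of_rot n C a b c (i j i' j' : 'I_3) : tree_context C ->
  rot3^-1%g i = i' -> rot3^-1%g j = j' ->
  class_of n (C (node3 (binom (X K i') j') a b c))
    = class_of n (C (node3 (binom (X K i) j) b c a)).
Proof.
move=> HC <- <-; rewrite class_of_binom_act // odd_permM !odd_tperm /= scale1r.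
by rewrite eq_node3; have [-> -> ->] := rot3V.
Qed.

(** [X K 0] is [a2,a3,a1], so a mark on a3 becomes a mark on the second argument of the bracket. *)
Lemma class_of_X0 n C a b c : tree_context C ->
  class_of n (C (node3 (binom (X K 0) 2) a b c))
    = class_of n (C (node3 (binom (X K 2) 1) b c a)).
Proof. by have [_ E1 E2] := rot3V => HC; apply: class_of_rot. Qed.

Lemma class_of_X1 n C a b c : tree_context C ->
  class_of n (C (node3 (binom (X K 1) 2) a b c))
    = class_of n (C (node3 (binom (X K 2) 0) c a b)).
Proof.
move=> HC; have [E0 E1 E2] := rot3V.
by rewrite (class_of_rot _ _ _ _ HC E0 E1) (class_of_rot _ _ _ _ HC E2 E0).
Qed.

Lemma pick_ord3 (P : pred 'I_3) :
  [pick i | P i] = if P 0 then Some 0 else if P 1 then Some 1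
                   else if P 2 then Some 2 else None.
Proof.
have E1 : lift ord0 ord0 = 1 :> 'I_3 by apply: val_inj.
have E2 : lift ord0 (lift ord0 ord0) = 2 :> 'I_3 by apply: val_inj.
rewrite /pick /enum_mem -enumT !enum_ordSl (size0nil (size_enum_ord 0)) /=.
rewrite E1 E2 /in_mem /=.
by do 3!case: ifP.
Qed.

Lemma ASp_X_tree (l : nat) (i : 'I_3) (a b c : tree (E K)) :
  ASp_tree l (X_tree i a b c)
    = node3 (if l \in leaves a then binom (X K i) 0
             else if l \in leaves b then binom (X K i) 1
             else if l \in leaves c then binom (X K i) 2
             else binom_star (X K i))
        (ASp_tree l a) (ASp_tree l b) (ASp_tree l c).
Proof.
rewrite /X_tree /= eq_node3 /=; congr node3.
rewrite pick_ord3 /=; do 3!case: ifP => //.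
Qed.

Lemma leaf3_labels (w : AE 3) :
  perm_eq (leaves (node3 w (Leaf 0) (Leaf 1) (Leaf 2))) (iota 0 3).
Proof. by rewrite leaves_node3. Qed.

Definition corolla (w : AE 3) : ntree AE 3 := NTree (leaf3_labels w).

Arguments ASp_tree : simpl never.
Arguments subst_leaves : simpl never.
Arguments node3 : simpl never.
Arguments X_tree : simpl never.

Lemma ASp_leaf (l i : nat) : ASp_tree l (Leaf i : tree (E K)) = Leaf i.
Proof. by []. Qed.

Lemma subst_leaf (M : smodule K) g i : subst_leaves g (Leaf i : tree M) = g i.
Proof. by []. Qed.

Lemma expr_class_of n (r : tree_expr AE n) :
  expr_class r = \sum_(ct <- r) ct.1 *: (class_of n ct.2 : free_operad AE n).
Proof. by apply: eq_bigr => ct _; rewrite class_of_ntree. Qed.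

Ltac expand_trees :=
  rewrite /ASp_expr ?big_map /r1 /r2 !big_cons big_nil /= ?big_nil !addr0 ?scale1r ?scaleN1r;
  rewrite /tree_graft /relabel ?subst_leavesA ?ASp_X_tree ?leaves_X_tree ?ASp_leaf /=;
  do 3?rewrite ?subst_node3 ?subst_leaf /=;
  rewrite ?addrA.

(** * Derivation of the relators marked at x2, x4 and x5 *)

Section InIdeal.
Variable I : ideal (free_operad AE).
Notation cl t := (class_of 5 t : free_operad AE 5).
Notation x_ i := (Leaf i.-1) (only parsing).
Notation T j := (node3 (binom (X K 2) j)).
Notation Ts := (node3 (binom_star (X K 2))).

Section Jacobi.
Hypothesis I1 : ideal_pred I (expr_class (ASp_expr (2 : 'I_3) (r1 K))).

Lemma jacobi_inner :
  ideal_pred I (cl (T 2 (x_ 1) (x_ 2) (T 2 (x_ 3) (x_ 4) (x_ 5)))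
    + cl (T 2 (x_ 1) (x_ 2) (T 1 (x_ 4) (x_ 5) (x_ 3)))
    + cl (T 2 (x_ 1) (x_ 2) (T 0 (x_ 5) (x_ 3) (x_ 4)))).
Proof.
have := ideal_graft_inner (2 : 'I_3) (corolla (binom (X K 2) 2)) I1.
move=> /(ideal_relabel (h := id)) => /(_ isT); expand_trees.
rewrite (class_of_X0 _ _ _ _ (context_node3_3 _ _ _)).
rewrite (class_of_X1 _ _ _ _ (context_node3_3 _ _ _)).
by rewrite addrC addrA.
Qed.

Lemma jacobi_outer0 :
  ideal_pred I (cl (T 2 (Ts (x_ 1) (x_ 2) (x_ 3)) (x_ 4) (x_ 5))
    + cl (T 1 (x_ 4) (x_ 5) (Ts (x_ 1) (x_ 2) (x_ 3)))
    + cl (T 0 (x_ 5) (Ts (x_ 1) (x_ 2) (x_ 3)) (x_ 4))).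
Proof.
have := ideal_graft_outer (0 : 'I_3) (corolla (binom_star (X K 2))) I1.
(* The mark x5 is not above the grafted D x3, whence the starred corolla. *)
move=> /(ideal_relabel (h := id)) => /(_ isT); expand_trees.
rewrite (class_of_X0 _ _ _ _ (@context_id _ _)).
rewrite (class_of_X1 _ _ _ _ (@context_id _ _)).
by rewrite addrC addrA.
Qed.

Lemma jacobi_outer1 :
  ideal_pred I (cl (T 2 (x_ 3) (Ts (x_ 1) (x_ 2) (x_ 4)) (x_ 5))
    + cl (T 1 (Ts (x_ 1) (x_ 2) (x_ 4)) (x_ 5) (x_ 3))
    + cl (T 0 (x_ 5) (x_ 3) (Ts (x_ 1) (x_ 2) (x_ 4)))).
Proof.
have := ideal_graft_outer (1 : 'I_3) (corolla (binom_star (X K 2))) I1.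
(* Grafting labels the leaves 0, (1, 2, 3), 4; the target is 2, (0, 1, 3), 4. *)
move=> /(ideal_relabel (h := nth 0 [:: 2; 0; 1; 3; 4]))%N => /(_ isT).
expand_trees.
rewrite (class_of_X0 _ _ _ _ (@context_id _ _)).
rewrite (class_of_X1 _ _ _ _ (@context_id _ _)).
by rewrite addrC addrA.
Qed.

Lemma jacobi_outer2 :
  ideal_pred I (cl (T 2 (x_ 3) (x_ 4) (T 2 (x_ 1) (x_ 2) (x_ 5)))
    + cl (T 1 (x_ 4) (T 2 (x_ 1) (x_ 2) (x_ 5)) (x_ 3))
    + cl (T 0 (T 2 (x_ 1) (x_ 2) (x_ 5)) (x_ 3) (x_ 4))).
Proof.
have := ideal_graft_outer (2 : 'I_3) (corolla (binom (X K 2) 2)) I1.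
(* The labels 0, 1, (2, 3, 4) become 2, 3, (0, 1, 4). *)
move=> /(ideal_relabel (h := nth 0 [:: 2; 3; 0; 1; 4]))%N => /(_ isT).
expand_trees.
rewrite (class_of_X0 _ _ _ _ (@context_id _ _)).
rewrite (class_of_X1 _ _ _ _ (@context_id _ _)).
by rewrite addrC addrA.
Qed.

End Jacobi.

Lemma ASp_r2_2 : ideal_pred I (expr_class (ASp_expr (0 : 'I_5) (r2 K))) ->
  ideal_pred I (expr_class (ASp_expr (1 : 'I_5) (r2 K))).
Proof.
move=> /(ideal_relabel (h := nth 0 [:: 1; 0; 2; 3; 4]))%N => /(_ isT) /idealN.
rewrite expr_class_of; expand_trees.
rewrite (class_of_swap0 _ (x_ 2) (x_ 1) _ (@context_id _ _)).
rewrite (class_of_swap0 _ (x_ 2) (x_ 1) _ (context_node3_1 _ _ _)).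
rewrite (class_of_swap0 _ (x_ 2) (x_ 1) _ (context_node3_2 _ _ _)).
rewrite (class_of_swap0 _ (x_ 2) (x_ 1) _ (context_node3_3 _ _ _)).
by rewrite !opprD !opprK.
Qed.

Lemma ASp_r2_4 : ideal_pred I (expr_class (ASp_expr (2 : 'I_5) (r2 K))) ->
  ideal_pred I (expr_class (ASp_expr (3 : 'I_5) (r2 K))).
Proof.
move=> /(ideal_relabel (h := nth 0 [:: 0; 1; 3; 2; 4]))%N => /(_ isT) /idealN.
rewrite expr_class_of; expand_trees.
rewrite !(class_of_swap0 _ _ _ _ (@context_id _ _)).
rewrite (class_of_swap0 _ _ _ _ (context_node3_3 _ _ _)).
(* Exchanging x3 and x4 also exchanges the terms containing D x3 and D x4. *)
by rewrite !opprD !opprK [X in _ -> ideal_pred I (X - _)]addrAC.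
Qed.

(** The rows are [r2] on (x3,x4,x5), (x4,x5,x3) and (x5,x3,x4); the groups on the right collect the
    terms with D outside, D x3, D x4 and D x5. *)
Lemma sum_cyclic (V : zmodType) (a1 a2 a3 a4 b1 b2 b3 b4 c1 c2 c3 c4 : V) :
  (a1 - a2 - a3 - a4) + (b1 - b2 - b3 - b4) + (c1 - c2 - c3 - c4)
    = (a1 + b1 + c1) - (a2 + b4 + c3) - (a3 + b2 + c4) - (a4 + b3 + c2).
Proof.
by rewrite !opprD !addrA [LHS](ACl (1*5*9*2*8*11*3*6*12*4*7*10)).
Qed.

Lemma ASp_r2_5 : ideal_pred I (expr_class (ASp_expr (2 : 'I_3) (r1 K))) ->
  ideal_pred I (expr_class (ASp_expr (2 : 'I_5) (r2 K))) ->
  ideal_pred I (expr_class (ASp_expr (4 : 'I_5) (r2 K))).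
Proof.
move=> I1 I3; have I4 := ASp_r2_4 I3.
(* Both cyclic shifts send the marked leaf, x3 here and x4 next, to x5. *)
move: I3 => /(ideal_relabel (h := nth 0 [:: 0; 1; 4; 2; 3]))%N => /(_ isT).
move: I4 => /(ideal_relabel (h := nth 0 [:: 0; 1; 3; 4; 2]))%N => /(_ isT).
rewrite expr_class_of; expand_trees => I4 I3.
have := idealD (idealD (idealD (jacobi_inner I1) (idealN (jacobi_outer0 I1)))
  (idealN (jacobi_outer1 I1))) (idealN (jacobi_outer2 I1)).
rewrite -sum_cyclic => /idealD /(_ (idealN I3)) /idealD /(_ (idealN I4)).
by rewrite addrK addrK.
Qed.

End InIdeal.

(** * Comparison of the two ideals *)

Lemma ASp_LTS_relators_preLTS (I : ideal (free_operad AE)) :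
  (forall k (r : free_operad AE k),
     relator_class (Q := preLTS_presentation K) r -> ideal_pred I r) ->
  forall k (r : free_operad AE k),
     relator_class (Q := ASp_LTS_presentation K) r -> ideal_pred I r.
Proof.
move=> IR; have I1 j : ideal_pred I (expr_class (ASp_expr j (r1 K))).
  by apply: IR; apply: (@RelatorClass _ (preLTS_presentation K));
     apply: preLTS_r1.
have I21 : ideal_pred I (expr_class (ASp_expr (0 : 'I_5) (r2 K))).
  by apply: IR; apply: (@RelatorClass _ (preLTS_presentation K));
     apply: preLTS_r2_1.
have I23 : ideal_pred I (expr_class (ASp_expr (2 : 'I_5) (r2 K))).
  by apply: IR; apply: (@RelatorClass _ (preLTS_presentation K));
     apply: preLTS_r2_3.
move=> k x [n e Re]; case: Re => m r j Rr; case: Rr j => j; first exact: I1.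
(* After case analysis, [j] becomes syntactically one of the numerals used in the lemmas. *)
have -> : j = nth 0 [:: 0; 1; 2; 3; 4] j.
  by apply: val_inj; case: j => -[|[|[|[|[|]]]]].
case: j => -[|[|[|[|[|//]]]]] _ /=.
- exact: I21.
- exact: ASp_r2_2.
- exact: I23.
- exact: ASp_r2_4.
- exact: ASp_r2_5.
Qed.

End Splitting.

(** Literal equality of ideals, by extensionality and proof irrelevance, makes the quotient operads
    equal and not merely isomorphic. *)
Lemma eq_ideal (K : fieldType) (P : operad K) (I J : ideal P) :
  (forall n (x : P n), ideal_pred I x <-> ideal_pred J x) -> I = J.
Proof.
case: I J => [I HI] [J HJ] /= IJ.
have E : I = J.
  apply: functional_extensionality_dep => n; apply/funext => x.
  exact/propext/IJ.
by move: HI HJ; rewrite E => HI HJ; congr exist; apply: Prop_irrelevance.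
Qed.

Theorem mainTheorem2 (K : fieldType) (charK : 2%N \notin [pchar K]) :
  (forall (n : nat) (x : free_operad (ASp_smodule (E K)) n),
     ideal_pred (relation_ideal (ASp_LTS_presentation K)) x <->
     ideal_pred (relation_ideal (preLTS_presentation K)) x) /\
  ASp_LTS K = preLTS K.
Proof.
have H (n : nat) (x : free_operad (ASp_smodule (E K)) n) :
    ideal_pred (relation_ideal (ASp_LTS_presentation K)) x <->
    ideal_pred (relation_ideal (preLTS_presentation K)) x.
  split=> Ix I IR; apply: Ix => k r.
    exact: ASp_LTS_relators_preLTS.
  move=> [m e Re]; apply: IR; apply: (@RelatorClass _ (ASp_LTS_presentation K)).
  case: Re => [j||]; apply: (@ASpRelator _ (LTS_presentation K)).
  - exact: LTS_r1.
  - exact: LTS_r2.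
  - exact: LTS_r2.
split=> //; have EI : relation_ideal (ASp_LTS_presentation K)
    = relation_ideal (preLTS_presentation K) by exact: eq_ideal.
exact: (f_equal (@quotient_operad K (free_operad (ASp_smodule (E K)))) EI).
Qed.
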